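(* Let $X$ be a Banach lattice with closed unit ball $B_X$. The following are equivalent: (i) $B_X$ is un-compact; (ii) $B_X$ is sequentially un-compact; (iii) $X$ is an atomic KB-space.
   Context: Let $X$ be a Banach lattice with positive cone $X_+$. A net $(x_\alpha)$ in $X$ un-converges to $x\in X$ if $\bigl\lVert |x_\alpha-x|\wedge u\bigr\rVert\to 0$ for every $u\in X_+$. The un-topology on $X$ is the linear topology whose base of zero neighborhoods is given by the sets $V_{\varepsilon,u}=\{x\in X : \lVert |x|\wedge u\rVert<\varepsilon\}$, where $\varepsilon>0$ and $0\ne u\in X_+$; convergence of nets in this topology is exactly un-convergence. A set $A\subseteq X$ is un-compact if it is compact in the un-topology, and sequentially un-compact if every sequence in $A$ has a subsequence which un-converges to an element of $A$. A Banach lattice is a KB-space if every norm bounded increasing sequence of positive vectors is norm convergent. A non-zero vector $a\in X_+$ is an atom if the principal ideal $I_a$ generated by $a$ coincides with $\operatorname{span}\{a\}$. $X$ is atomic if $X$ is the band generated by all the atoms of $X$. *)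

(* Defs.v *)
From HB Require Import structures.
From mathcomp Require Import all_boot all_order all_algebra.
From mathcomp Require Import all_classical all_reals all_analysis.
Import Order.TTheory GRing.Theory Num.Theory numFieldNormedType.Exports.

Set Implicit Arguments.
Unset Strict Implicit.
Unset Printing Implicit Defensive.

Local Open Scope classical_set_scope.
Local Open Scope ring_scope.

(* The order enters through raw fields because the hierarchy reserves the     *)
(* join of its order and norm structures for numDomainType. The canonical     *)
(* instances below then equip every Banach lattice with the library's         *)
(* lattice structure, so that <=, `&` and `|` are the library's.              *)
HB.mixin Record isBanachLattice (R : realType) X of CompleteNormedModule R X := {
  vle : rel X ;
  vmeet : X -> X -> X ;
  vjoin : X -> X -> X ;
  vle_refl : reflexive vle ;
  vle_anti : antisymmetric vle ;
  vle_trans : transitive vle ;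
  vmeetP : forall x y z : X, vle x (vmeet y z) = vle x y && vle x z ;
  vjoinP : forall x y z : X, vle (vjoin x y) z = vle x z && vle y z ;
  vle_add2l : forall z x y : X, vle x y -> vle (z + x) (z + y) ;
  vle_scale : forall (c : R) (x : X), 0 <= c -> vle 0 x -> vle 0 (c *: x) ;
  vle_norm : forall x y : X,
    vle (vjoin x (- x)) (vjoin y (- y)) -> `|x| <= `|y|
}.

#[short(type="banachLatticeType")]
HB.structure Definition BanachLattice (R : realType) :=
  {X of CompleteNormedModule R X & isBanachLattice R X}.

#[non_forgetful_inheritance]
HB.instance Definition _ (R : realType) (X : banachLatticeType R) :=
  Order.Le_isPOrder.Build ring_display (BanachLattice.sort X)
    (@vle_refl R X) (@vle_anti R X) (@vle_trans R X).

#[non_forgetful_inheritance]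
HB.instance Definition _ (R : realType) (X : banachLatticeType R) :=
  Order.POrder_MeetJoin_isLattice.Build ring_display (BanachLattice.sort X)
    (@vmeetP R X) (@vjoinP R X).

(* The modulus of x, as opposed to its norm `|x| : R. *)
Definition vabs (R : realType) (X : banachLatticeType R) (x : X) : X :=
  (x `|` - x)%O.

Section vector_lattice_theory.
Context (R : realType) (X : banachLatticeType R).
Implicit Types x y z u a b : X.

Lemma vlerD2l z x y : x <= y -> z + x <= z + y.
Proof. exact: vle_add2l. Qed.

Lemma vscaler_ge0 (c : R) x : 0 <= c -> 0 <= x -> 0 <= c *: x.
Proof. exact: vle_scale. Qed.

Lemma vlerD x y a b : x <= y -> a <= b -> x + a <= y + b.
Proof.
move=> xy ab; apply: (le_trans (vlerD2l x ab)).
by rewrite addrC [leRHS]addrC; exact: vlerD2l.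
Qed.

Lemma vsubr_ge0 x y : (0 <= y - x) = (x <= y).
Proof.
apply/idP/idP => [/(vlerD2l x)|/(vlerD2l (- x))].
  by rewrite addr0 addrCA subrr addr0.
by rewrite addNr addrC.
Qed.

Lemma vlerBlDr x y z : (x - y <= z) = (x <= z + y).
Proof. by rewrite -(vsubr_ge0 (x - y)) opprB addrA vsubr_ge0. Qed.

Lemma lattice_norm_le x y : vabs x <= vabs y -> `|x| <= `|y|.
Proof. exact: vle_norm. Qed.

Lemma vabs_ge0 x : 0 <= vabs x.
Proof.
have : 0 <= vabs x + vabs x by rewrite -(subrr x); apply: vlerD;
  [exact: leUl | exact: leUr].
have h : (0 : R) <= 2^-1 by rewrite invr_ge0.
rewrite -mulr2n -scaler_nat => /(vscaler_ge0 h).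
by rewrite scalerA mulVf ?scale1r // pnatr_eq0.
Qed.

Lemma vabs0 : vabs (0 : X) = 0.
Proof. by rewrite /vabs oppr0 joinxx. Qed.

Lemma vabsN x : vabs (- x) = vabs x.
Proof. by rewrite /vabs opprK joinC. Qed.

Lemma ge0_vabs x : 0 <= x -> vabs x = x.
Proof.
move=> x0; rewrite /vabs; apply/join_idPl; apply: (le_trans _ x0).
by rewrite -[- x]add0r vlerBlDr add0r.
Qed.

Lemma vabsD x y : vabs (x + y) <= vabs x + vabs y.
Proof.
rewrite leUx opprD; apply/andP; split; apply: vlerD;
  by [exact: leUl | exact: leUr].
Qed.

Lemma ge0_norm_le x y : 0 <= x -> x <= y -> `|x| <= `|y|.
Proof.
move=> x0 xy; apply: lattice_norm_le; rewrite !ge0_vabs //.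
exact: le_trans xy.
Qed.

Lemma vmeetDl a b u : 0 <= a -> 0 <= b -> 0 <= u ->
  ((a + b) `&` u <= a `&` u + b `&` u)%O.
Proof.
move=> a0 b0 u0; set w := ((a + b) `&` u)%O.
have wab : w <= a + b by exact: leIl.
have wu : w <= u by exact: leIr.
have wuD v : 0 <= v -> w <= v + u.
  by move=> v0; rewrite -[w]add0r; exact: vlerD.
have wuD' v : 0 <= v -> w <= u + v by rewrite addrC; exact: wuD.
rewrite addrC -vlerBlDr lexI; apply/andP; split;
  by rewrite vlerBlDr addrC -vlerBlDr lexI !vlerBlDr ?wab ?wuD ?wuD'.
Qed.

End vector_lattice_theory.

Section un_topology.
Context (R : realType) (X : banachLatticeType R).
Implicit Types (x y z u : X) (e : R).

(* Net-style convergence of f along a filter F on its index type. *)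
Definition un_cvg (T : Type) (F : set_system T) (f : T -> X) x :=
  forall u, 0 <= u -> `|(vabs (f t - x) `&` u)%O| @[t --> F] --> (0 : R).

Definition un_V e u : set X := [set x | `|(vabs x `&` u)%O| < e].

(* Allowing u = 0 only adds un_V e 0 = setT to the base, which makes it       *)
(* nonempty even when X = {0}.                                                *)
Definition un_nbhs x : set_system X :=
  filter_from [set eu : R * X | 0 < eu.1 /\ 0 <= eu.2]
    (fun eu => [set y | un_V eu.1 eu.2 (y - x)]).

Lemma un_V0 e u : 0 < e -> 0 <= u -> un_V e u 0.
Proof. by move=> e0 u0; rewrite /un_V /= vabs0 meet_l // normr0. Qed.

Lemma un_VD e1 e2 u x y : 0 <= u ->
  un_V e1 u x -> un_V e2 u y -> un_V (e1 + e2) u (x + y).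
Proof.
move=> u0 xV yV; apply: le_lt_trans (ltrD xV yV).
apply: le_trans (ler_normD _ _); apply: ge0_norm_le.
  by rewrite lexI vabs_ge0.
by apply: le_trans (vmeetDl (vabs_ge0 x) (vabs_ge0 y) u0); exact: leI2 (vabsD x y) _.
Qed.

Lemma un_V_sub d e u v : 0 <= u -> d <= e -> u <= v -> un_V d v `<=` un_V e u.
Proof.
move=> u0 de uv x xV; apply: le_lt_trans (lt_le_trans xV de).
by apply: ge0_norm_le; [rewrite lexI vabs_ge0|exact: leI2].
Qed.

Lemma un_nbhs_filter x : ProperFilter (un_nbhs x).
Proof.
apply: filter_from_proper; last first.
  by move=> [e u] [e0 u0]; exists x; rewrite /= subrr; exact: un_V0.
apply: filter_from_filter; first by exists (1, 0); split => //=.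
move=> [e u] [d v] /= [e0 u0] [d0 v0]; exists (Num.min e d, (u `|` v)%O).
  by split => /=; [rewrite lt_min e0 | apply: le_trans u0 _; exact: leUl].
move=> y /= yV; split; apply: un_V_sub yV => //; by [rewrite ge_min lexx ?orbT |
  exact: leUl | exact: leUr].
Qed.

Lemma un_nbhs_singleton x (A : set X) : un_nbhs x A -> A x.
Proof.
by move=> [[e u] [e0 u0]]; apply; rewrite /= subrr; exact: un_V0.
Qed.

Lemma un_nbhs_nbhs x (A : set X) : un_nbhs x A -> un_nbhs x (un_nbhs^~ A).
Proof.
move=> [[e u] /= [e0 u0] sA].
have e20 : 0 < e / 2 by rewrite divr_gt0.
exists (e / 2, u) => // y yV; exists (e / 2, u) => // z zV; apply: sA => /=.
by rewrite -(subrKA y) [e]splitr; exact: un_VD.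
Qed.

End un_topology.

(* A copy of X carrying the un-topology instead of the norm topology. *)
Definition un_space (R : realType) (X : banachLatticeType R) : Type := X.

HB.instance Definition _ (R : realType) (X : banachLatticeType R) :=
  Choice.copy (un_space X) (BanachLattice.sort X).

HB.instance Definition _ (R : realType) (X : banachLatticeType R) :=
  hasNbhs.Build (un_space X) (@un_nbhs R X).

HB.instance Definition _ (R : realType) (X : banachLatticeType R) :=
  Nbhs_isNbhsTopological.Build (un_space X) (@un_nbhs_filter R X)
    (@un_nbhs_singleton R X) (@un_nbhs_nbhs R X).

Lemma un_cvgP (R : realType) (X : banachLatticeType R) (T : Type)
    (F : set_system T) (f : T -> X) (x : X) : Filter F ->
  un_cvg F f x <-> (f @ F --> (x : un_space X)).
Proof.
move=> FF; split=> [fx A [[e u] /= [e0 u0] sA]|fx u u0].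
  move: (fx u u0) => /cvgrPdist_lt/(_ e e0) .
  apply: (@filterS T F) => t /=.
  by rewrite sub0r normrN normr_id => /sA.
apply/cvgrPdist_lt => e e0.
have : nbhs (x : un_space X) [set y | un_V e u (y - x)] by exists (e, u).
by move=> /fx; apply: (@filterS T F) => t /=; rewrite sub0r normrN normr_id.
Qed.

Section un_compactness.
Context (R : realType) (X : banachLatticeType R).

Definition un_compact (A : set X) := compact (A : set (un_space X)).

Definition seq_un_compact (A : set X) :=
  forall x : X^nat, (forall n, A (x n)) ->
    exists k : nat -> nat, {homo k : m n / (m < n)%N} /\
      exists2 l, A l & un_cvg \oo (x \o k) l.

Definition closed_unit_ball : set X := [set x | `|x| <= 1].

Definition KB_space :=
  forall x : X^nat, (forall n, 0 <= x n) -> nondecreasing_seq x ->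
    bounded_fun x -> cvgn x.

End un_compactness.

Arguments closed_unit_ball {R} X.

Section ideals_bands_atoms.
Context (R : realType) (X : banachLatticeType R).
Implicit Types (A I B : set X) (a x y : X).

Definition order_ideal I :=
  [/\ I 0, forall x y, I x -> I y -> I (x + y),
      forall (c : R) x, I x -> I (c *: x) &
      forall x y, I y -> vabs x <= vabs y -> I x].

(* A band contains the supremum of each of its subsets having one in X. *)
Definition band B :=
  order_ideal B /\ forall A x, A `<=` B -> supremums A x -> B x.

Definition principal_ideal a : set X := smallest order_ideal [set a].

Definition generated_band A : set X := smallest band A.

Definition atom a :=
  [/\ 0 <= a, a != 0 & principal_ideal a = range (fun c : R => c *: a)].

End ideals_bands_atoms.

Definition atomic (R : realType) (X : banachLatticeType R) :=
  generated_band [set a : X | atom a] = setT.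

(* Main.v *)
(** If every sequence of the unit ball has an un-cluster point in the ball, then
    a norm bounded increasing positive sequence is dominated by its cluster
    point, so un-convergence turns into norm convergence: X is a KB-space. In a
    KB-space a subsequence is then extracted by testing against one vector that
    dominates all terms of the sequence up to scalars.

    Atoms: take v > 0 with no atom below it and a positive functional f with
    f v = ||v|| (Hahn-Banach). Every component Q of v splits into two disjoint
    parts of f-mass at least f Q / 3; otherwise the components of mass at least
    f Q / 2 would have a minimal one, which is an atom. Splitting repeatedly
    yields components of v at mutual distance at least f v / 3, which contradicts
    sequential un-compactness.

    Conversely, fix an ultrafilter. The x such that every function into [0, |x|]
    converges in norm along it form a closed ideal, hence a band in a KB-space.
    This band contains the atoms, so it is X. The limits of the truncations
    x^+ /\ u and x^- /\ u thus exist; they are norm bounded and increasing in u,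
    hence converge, and their limits give the un-limit of the ultrafilter. *)
Require Import Defs.
From mathcomp Require Import all_boot all_order all_algebra.
From mathcomp Require Import all_classical all_reals all_analysis.
From mathcomp Require Import lra.
Import Order.TTheory GRing.Theory Num.Theory numFieldNormedType.Exports.

Set Implicit Arguments.
Unset Strict Implicit.
Unset Printing Implicit Defensive.

Local Open Scope classical_set_scope.
Local Open Scope ring_scope.


(** * Vector lattice inequalities *)


Section vector_lattice.
Context (R : realType) (X : banachLatticeType R).
Implicit Types (x y z u a b : X) (c d : R).

Lemma vlerBrDr x y z : (x <= y - z) = (x + z <= y).
Proof. by rewrite -(vsubr_ge0 x) -addrA -opprD vsubr_ge0 [z + x]addrC. Qed.

Lemma vlerN2 x y : (- x <= - y) = (y <= x).
Proof. by rewrite -(vsubr_ge0 (- x)) opprK addrC vsubr_ge0. Qed.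

Lemma vlerNl x y : (- x <= y) = (- y <= x).
Proof. by rewrite -[X in _ = X]vlerN2 opprK. Qed.

Lemma vlerD2r z x y : (x + z <= y + z) = (x <= y).
Proof. by rewrite -(vsubr_ge0 (x + z)) opprD addrACA subrr addr0 vsubr_ge0. Qed.

Lemma vler_wpDr x y z : 0 <= z -> x <= y -> x <= y + z.
Proof. by move=> z0 xy; rewrite -[x]addr0; exact: vlerD. Qed.

Lemma vler_wpDl x y z : 0 <= z -> x <= y -> x <= z + y.
Proof. by rewrite addrC; exact: vler_wpDr. Qed.

Lemma vaddr_ge0 x y : 0 <= x -> 0 <= y -> 0 <= x + y.
Proof. by move=> x0 y0; exact: vler_wpDr. Qed.

Lemma vler_wBDr x y z : 0 <= z -> x <= y -> x - z <= y.
Proof. by move=> z0 xy; rewrite vlerBlDr; exact: vler_wpDr. Qed.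

Lemma voppr_le0 x : (- x <= 0) = (0 <= x).
Proof. by rewrite -{1}oppr0 vlerN2. Qed.

Lemma vjoinDr x y z : (x `|` y)%O + z = ((x + z) `|` (y + z))%O.
Proof.
apply: le_anti; rewrite -vlerBrDr !leUx !vlerBrDr leUl leUr /=.
by rewrite !vlerD2r leUl leUr.
Qed.

Lemma vmeetDr x y z : (x `&` y)%O + z = ((x + z) `&` (y + z))%O.
Proof.
apply: le_anti; rewrite !lexI !vlerD2r leIl leIr /=.
by rewrite -vlerBlDr !lexI !vlerBlDr leIl leIr.
Qed.

Lemma voppI x y : - (x `&` y)%O = (- x `|` - y)%O.
Proof.
apply: le_anti; rewrite leUx !vlerN2 leIl leIr /= andbT vlerNl lexI.
by rewrite [_ <= x]vlerNl [_ <= y]vlerNl leUl leUr.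
Qed.

Definition vpos x : X := (x `|` 0)%O.

Lemma vpos_ge0 x : 0 <= vpos x. Proof. exact: leUr. Qed.

Lemma le_vpos x : x <= vpos x. Proof. exact: leUl. Qed.

Lemma vpos_le x y : 0 <= y -> x <= y -> vpos x <= y.
Proof. by move=> y0 xy; rewrite leUx xy. Qed.

Lemma vposE x : 0 <= x -> vpos x = x.
Proof. by move=> x0; apply/join_idPl. Qed.

Lemma vsubrI x y : x - (x `&` y)%O = vpos (x - y).
Proof. by rewrite voppI addrC vjoinDr addNr joinC addrC. Qed.

Lemma vpos_subN x : vpos x - vpos (- x) = x.
Proof.
rewrite /vpos -[X in (- x `|` X)%O]oppr0 -voppI opprK.
have -> : (x `&` 0)%O = x - vpos x.
  by rewrite -[x in RHS]subr0 -vsubrI subr0 opprB addrCA subrr addr0.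
by rewrite addrCA subrr addr0.
Qed.

Lemma le_vabs x : x <= vabs x. Proof. exact: leUl. Qed.

Lemma leN_vabs x : - x <= vabs x. Proof. exact: leUr. Qed.

Lemma vpos_le_vabs x : vpos x <= vabs x.
Proof. by apply: vpos_le; [exact: vabs_ge0 | exact: le_vabs]. Qed.



Lemma vposD x : vpos x = x + vpos (- x).
Proof. by rewrite -{2}[x]vpos_subN subrK. Qed.

Lemma vpos_meetN x : (vpos x `&` vpos (- x))%O = 0.
Proof.
rewrite vposD -[X in (_ `&` X)%O]add0r -vmeetDr.
rewrite [X in X + _](_ : _ = - vpos (- x)) ?addNr //.
by rewrite -[LHS]opprK voppI oppr0.
Qed.

Lemma vpos_addN x : vpos x + vpos (- x) = vabs x.
Proof.
apply: le_anti; apply/andP; split; last first.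
  rewrite leUx vler_wpDr ?vpos_ge0 ?le_vpos //=.
  by rewrite vler_wpDl ?vpos_ge0 ?le_vpos.
rewrite {1}/vpos vjoinDr add0r -vposD leUx vpos_le_vabs /=.
by rewrite -vabsN vpos_le_vabs.
Qed.

Lemma vabs_le x y : (vabs x <= y) = (x <= y) && (- x <= y).
Proof. by rewrite leUx. Qed.

Lemma vabs_vabs x : vabs (vabs x) = vabs x.
Proof. by rewrite ge0_vabs ?vabs_ge0. Qed.

Lemma norm_vabs x : `|vabs x| = `|x|.
Proof. by apply: le_anti; rewrite !lattice_norm_le ?vabs_vabs. Qed.

Lemma vabs_le_norm x y : vabs x <= y -> `|x| <= `|y|.
Proof. by move=> xy; rewrite -norm_vabs; apply: ge0_norm_le => //; exact: vabs_ge0. Qed.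

Lemma vdistC x y : vabs (x - y) = vabs (y - x).
Proof. by rewrite -vabsN opprB. Qed.

Lemma le_addvabs x y : x <= y + vabs (x - y).
Proof. by rewrite addrC -vlerBlDr le_vabs. Qed.

Lemma vabs_meet_le x y z : vabs ((x `&` z)%O - (y `&` z)%O) <= vabs (x - y).
Proof.
have main p q : (p `&` z)%O - (q `&` z)%O <= vabs (p - q).
  rewrite vlerBlDr addrC vmeetDr; apply: leI2; first exact: le_addvabs.
  by rewrite vler_wpDr ?vabs_ge0.
by rewrite vabs_le main opprB vdistC main.
Qed.

Lemma vabs_pos_le x y : vabs (vpos x - vpos y) <= vabs (x - y).
Proof.
have main p q : vpos p - vpos q <= vabs (p - q).
  rewrite vlerBlDr addrC leUx vaddr_ge0 ?vpos_ge0 ?vabs_ge0 // andbT.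
  by rewrite (le_trans (le_addvabs p q)) // vlerD2r le_vpos.
by rewrite vabs_le main opprB vdistC main.
Qed.

Lemma norm_meet_le x y z : `|(x `&` z)%O - (y `&` z)%O| <= `|x - y|.
Proof. by apply: lattice_norm_le; exact: vabs_meet_le. Qed.

Lemma norm_pos_le x y : `|vpos x - vpos y| <= `|x - y|.
Proof. by apply: lattice_norm_le; exact: vabs_pos_le. Qed.

Lemma norm_eps_eq0 x : (forall e : R, 0 < e -> `|x| <= e) -> x = 0.
Proof.
move=> xe; apply/eqP; rewrite -normr_le0.
by apply/ler_addgt0Pl => e e0; rewrite addr0 xe.
Qed.

Lemma vpos_eq0 x : (vpos x == 0) = (x <= 0).
Proof. by rewrite eq_le vpos_ge0 andbT leUx lexx andbT. Qed.

(** The negative part is 1-Lipschitz in norm and vanishes on the cone, so the cone is norm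
    closed. *)
Lemma ge0_norm_approx x :
  (forall e : R, 0 < e -> exists2 y, 0 <= y & `|y - x| <= e) -> 0 <= x.
Proof.
move=> xe; rewrite -voppr_le0 -vpos_eq0; apply/eqP/norm_eps_eq0 => e /xe[y y0].
apply: le_trans; have /eqP yE : vpos (- y) == 0 by rewrite vpos_eq0 voppr_le0.
by rewrite -[vpos _]subr0 -yE (le_trans (norm_pos_le _ _)) // opprK addrC.
Qed.

Lemma le_norm_approx x y :
  (forall e : R, 0 < e -> exists2 z, x <= z & `|z - y| <= e) -> x <= y.
Proof.
move=> xye; rewrite -vsubr_ge0; apply: ge0_norm_approx => e /xye[z xz zy].
by exists (z - x); rewrite ?vsubr_ge0 // opprB addrA subrK.
Qed.

Lemma vmulrn_ge0 x n : 0 <= x -> 0 <= x *+ n.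
Proof. by move=> x0; elim: n => // n IH; rewrite mulrS vaddr_ge0. Qed.

Lemma varchimedean x y : 0 <= x -> (forall n, x *+ n <= y) -> x = 0.
Proof.
move=> x0 xy; apply/eqP; rewrite -normr_le0 leNgt; apply/negP => nx0.
have := archi_boundP (divr_ge0 (normr_ge0 y) (ltW nx0)).
rewrite ltr_pdivrMr // ltNge => /negP; apply.
rewrite mulr_natl -normrMn.
by apply: ge0_norm_le; [exact: vmulrn_ge0 | exact: xy].
Qed.

Lemma meet0_le a b x y : 0 <= x -> 0 <= y -> x <= a -> y <= b ->
  (a `&` b)%O = 0 -> (x `&` y)%O = 0.
Proof.
move=> x0 y0 xa yb ab; apply: le_anti; rewrite lexI x0 y0 andbT.
by rewrite -[X in _ <= X]ab leI2.
Qed.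

Lemma meet0D a b u : 0 <= a -> 0 <= b -> 0 <= u ->
  (a `&` u)%O = 0 -> (b `&` u)%O = 0 -> ((a + b) `&` u)%O = 0.
Proof.
move=> a0 b0 u0 au bu; apply: le_anti; rewrite lexI vaddr_ge0 // u0 /= andbT.
by rewrite (le_trans (vmeetDl a0 b0 u0)) // au bu addr0.
Qed.

Lemma meet0Mn a u n : 0 <= a -> 0 <= u -> (a `&` u)%O = 0 -> ((a *+ n) `&` u)%O = 0.
Proof.
move=> a0 u0 au; elim: n => [|n IH]; first by apply/meet_idPl.
by rewrite mulrS meet0D // vmulrn_ge0.
Qed.

Lemma join_disjoint a b : (a `&` b)%O = 0 -> (a `|` b)%O = a + b.
Proof.
move=> ab; apply/eqP; rewrite -subr_eq -[X in _ + X]/(- b) vjoinDr subrr.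
by rewrite -[X in X == _]/(vpos (a - b)) -vsubrI ab subr0.
Qed.

Lemma vabsD_disjoint x y :
  (vabs x `&` vabs y)%O = 0 -> vabs (x + y) = vabs x + vabs y.
Proof.
(* Meet |p| <= |p + q| + |q| with |p|: subadditivity of the meet splits the right side, and
   disjointness removes |q|. *)
have main p q : (vabs p `&` vabs q)%O = 0 -> vabs p <= vabs (p + q).
  move=> pq; have : vabs p <= vabs (p + q) + vabs q.
    by rewrite -{1}[p](addrK q) (le_trans (vabsD _ _)) // vabsN.
  move=> le1; have : (vabs p `&` (vabs (p + q) + vabs q))%O = vabs p.
    exact/meet_idPl.
  move=> {1}<-; rewrite meetC (le_trans (vmeetDl _ _ _)) ?vabs_ge0 //.
  by rewrite [(vabs q `&` _)%O]meetC pq addr0 leIl.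
move=> xy; apply: le_anti; rewrite vabsD -join_disjoint // leUx main //=.
by rewrite addrC main // meetC.
Qed.

Lemma meetD_disjoint a b u : 0 <= a -> 0 <= b -> 0 <= u ->
  (a `&` b)%O = 0 -> (u `&` (a + b))%O = (u `&` a)%O + (u `&` b)%O.
Proof.
move=> a0 b0 u0 ab; apply: le_anti; apply/andP; split.
  by rewrite ![(u `&` _)%O]meetC vmeetDl.
have uab : ((u `&` a) `&` (u `&` b))%O = 0.
  by apply: meet0_le ab; rewrite ?lexI ?u0 ?a0 ?b0 ?leIr.
rewrite -join_disjoint // leUx !leI2 //; first exact: vler_wpDl.
exact: vler_wpDr.
Qed.

Lemma vler_scale2l c x y : 0 <= c -> x <= y -> c *: x <= c *: y.
Proof.
move=> c0 xy; rewrite -vsubr_ge0 -scalerBr; apply: vscaler_ge0 => //.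
by rewrite vsubr_ge0.
Qed.

Lemma vler_scale2r c d x : 0 <= x -> c <= d -> c *: x <= d *: x.
Proof. by move=> x0 cd; rewrite -vsubr_ge0 -scalerBl vscaler_ge0 // subr_ge0. Qed.

Lemma vmeetZ c x y : 0 < c -> c *: (x `&` y)%O = ((c *: x) `&` (c *: y))%O.
Proof.
move=> c0; have c1 : 0 <= c^-1 by rewrite invr_ge0 ltW.
have c0' := ltW c0.
apply: le_anti; apply/andP; split.
  by rewrite lexI !vler_scale2l ?leIl ?leIr.
rewrite -[leLHS](scalerKV (lt0r_neq0 c0)); apply: vler_scale2l => //.
rewrite lexI -[leRHS](scalerK (lt0r_neq0 c0)) vler_scale2l ?leIl //=.
by rewrite -[leRHS](scalerK (lt0r_neq0 c0)) vler_scale2l ?leIr.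
Qed.

Lemma vabsZ c x : 0 < c -> vabs (c *: x) = c *: vabs x.
Proof.
move=> c0; have c1 : 0 <= c^-1 by rewrite invr_ge0 ltW.
have c0' := ltW c0.
apply: le_anti; apply/andP; split.
  by rewrite vabs_le -scalerN !vler_scale2l ?le_vabs ?leN_vabs.
rewrite -[leRHS](scalerKV (lt0r_neq0 c0)); apply: vler_scale2l => //.
rewrite vabs_le -{1}[x](scalerK (lt0r_neq0 c0)) vler_scale2l ?le_vabs //=.
by rewrite -{1}[x](scalerK (lt0r_neq0 c0)) -scalerN vler_scale2l ?leN_vabs.
Qed.

End vector_lattice.

(** * Convergence in KB-spaces *)


Section KB.
Context (R : realType) (X : banachLatticeType R).
Implicit Types (x y z u v a b c : X) (e : R).

Lemma nondecreasing_of_step (x : X^nat) :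
  (forall n, x n <= x n.+1) -> nondecreasing_seq x.
Proof. by move=> h m n; apply: (homo_leq (@le_refl _ X) (@le_trans _ X)). Qed.

Lemma invn_lt e : 0 < e -> exists N, forall n, (N <= n)%N -> n.+1%:R^-1 < e.
Proof. by move=> e0; have [N _] := near_infty_natSinv_lt (PosNum e0); exists N. Qed.

Hypothesis KB : KB_space X.

Lemma KB_cvg (x : X^nat) (C : R) :
  (forall n, 0 <= x n) -> (forall n, x n <= x n.+1) ->
  (forall n, `|x n| <= C) ->
  exists2 l, (forall n, x n <= l) &
    forall e, 0 < e -> exists N, forall n, (N <= n)%N -> `|x n - l| <= e.
Proof.
move=> x0 xS xC; have xnd := nondecreasing_of_step xS.
have xb : bounded_fun x.
  by exists C; split; [exact: num_real | move=> M CM n _; exact: le_trans (ltW CM)].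
have /cvg_ex[l xl] := KB x0 xnd xb.
have xe e : 0 < e -> exists N, forall n, (N <= n)%N -> `|x n - l| <= e.
  move=> e0; have /cvgrPdist_le/(_ e e0)[N _ NP] := xl.
  by exists N => n Nn; rewrite distrC; exact: NP.
exists l => // n; apply: le_norm_approx => e /xe[N NP].
exists (x (maxn N n)); first by apply: xnd; exact: leq_maxr.
exact/NP/leq_maxl.
Qed.

Lemma KB_cvg_decr (x : X^nat) :
  (forall n, 0 <= x n) -> (forall n, x n.+1 <= x n) ->
  exists l, [/\ 0 <= l, forall n, l <= x n &
    forall e, 0 < e -> exists N, forall n, (N <= n)%N -> `|x n - l| <= e].
Proof.
move=> x0 xS.
have xle n : x n <= x 0%N by elim: n => // n; exact: le_trans.
have [|n|n|l xl lim] := @KB_cvg (fun n => x 0%N - x n) (`|x 0%N|).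
- by move=> n; rewrite vsubr_ge0.
- by apply: vlerD; rewrite ?vlerN2.
- by apply: ge0_norm_le; [rewrite vsubr_ge0 | exact: vler_wBDr].
have dl n : x n - (x 0%N - l) = - (x 0%N - x n - l).
  by rewrite !opprB addrCA.
exists (x 0%N - l); split.
- apply: ge0_norm_approx => e /lim[N NP]; exists (x N) => //.
  by rewrite dl normrN NP.
- by move=> n; rewrite vlerBlDr addrC -vlerBlDr.
by move=> e /lim[N NP]; exists N => n /NP; rewrite dl normrN.
Qed.

(** Carries the KB property from sequences to directed sets, as needed for suprema in bands and for
    nets of truncations. *)
Lemma KB_directed (D : set X) (C : R) : D !=set0 ->
  (forall x, D x -> 0 <= x) -> (forall x, D x -> `|x| <= C) ->
  (forall x y, D x -> D y -> exists z, [/\ D z, x <= z & y <= z]) ->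
  exists2 l, (forall x, D x -> x <= l) &
    forall e, 0 < e ->
      exists2 b, D b & forall c, D c -> b <= c -> `|c - l| <= e.
Proof.
move=> [d0 Dd0] D0 DC Ddir.
(* Otherwise each member of D has a larger one more than e away, and iteration builds an increasing
   bounded sequence that is not Cauchy. *)
have cauchy e : 0 < e ->
    exists2 b, D b & forall c, D c -> b <= c -> `|c - b| <= e.
  move=> e0; apply: contrapT => no.
  have step (b : {x | D x}) :
      exists c : {x | D x}, sval b <= sval c /\ e < `|sval c - sval b|.
    case: b => b Db /=; apply: contrapT => nob; apply: no; exists b => // c Dc bc.
    rewrite leNgt; apply/negP => ebc; apply: nob.
    by exists (exist _ c Dc).
  have [g gP] := choice step.
  pose s n := sval (iter n g (exist _ d0 Dd0)).
  have Ds n : D (s n) by rewrite /s; case: (iter _ _ _).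
  have [n|n|n|l _ /(_ (e / 2))[|N NP]] := @KB_cvg s C.
  - exact: D0.
  - exact: (gP _).1.
  - exact: DC.
  - by rewrite divr_gt0.
  have : e < `|s N.+1 - s N| by exact: (gP _).2.
  rewrite ltNge => /negP; apply; rewrite [e]splitr -(subrKA l).
  by rewrite (le_trans (ler_normD _ _)) // lerD ?NP // distrC NP.
have /choice[b bP] (n : nat) : exists b, D b /\
    forall c, D c -> b <= c -> `|c - b| <= n.+1%:R^-1.
  by have [|b] := cauchy n.+1%:R^-1; [rewrite invr_gt0 | exists b].
have /choice[g gP] (p : nat * {x | D x}) :
    exists z : {x | D x}, sval p.2 <= sval z /\ b p.1 <= sval z.
  case: p => n [x Dx] /=; have [z [Dz xz bz]] := Ddir x (b n) Dx (bP n).1.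
  by exists (exist _ z Dz).
(* Since [s n.+1] lies above [b n], all members of D above it are within 1/(n+1) of [b n]; the limit
   of this one sequence thus serves all of D. *)
pose s := fix s n := if n is n'.+1 then g (n', s n') else exist _ d0 Dd0.
have Ds n : D (sval (s n)) by case: (s n).
have [n|n|n|l sl lim] := @KB_cvg (fun n => sval (s n)) C.
- exact: D0.
- exact: (gP (n, s n)).1.
- exact: DC.
have snd := nondecreasing_of_step (fun n => (gP (n, s n)).1).
have near_l n c : D c -> sval (s n.+1) <= c -> `|c - l| <= n.+1%:R^-1 *+ 2.
  move=> Dc sc; have bs := (gP (n, s n)).2.
  rewrite -(subrKA (b n)) (le_trans (ler_normD _ _)) // mulr2n lerD //.
    by rewrite (bP n).2 // (le_trans bs).
  apply/ler_addgt0Pl => e /lim[N NP].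
  rewrite distrC -(subrKA (sval (s (maxn N n.+1)))).
  rewrite (le_trans (ler_normD _ _)) // lerD //.
    by rewrite distrC NP // leq_maxl.
  rewrite (bP n).2 // (le_trans bs) //.
  exact: (snd n.+1 _ (leq_maxr _ _)).
have near_l' e : 0 < e -> exists n, forall c, D c -> sval (s n) <= c -> `|c - l| <= e.
  move=> e0; have [|N NP] := @invn_lt (e / 2); first by rewrite divr_gt0.
  exists N.+1 => c Dc sc; rewrite (le_trans (near_l _ _ Dc sc)) //.
  by rewrite -[leLHS]mulr_natr -ler_pdivlMr // ltW // NP.
exists l => [x Dx|e /near_l'[n nP]]; last by exists (sval (s n)).
apply: le_norm_approx => e /near_l'[n nP].
by have [z [Dz xz sz]] := Ddir _ _ Dx (Ds n); exists z => //; exact: nP.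
Qed.
End KB.

(** * Cluster points and subsequences *)


Section un_cluster.
Context (R : realType) (X : banachLatticeType R).
Implicit Types (x y z u v l : X) (e : R).

Definition un_cluster (x : X^nat) l := forall u e N, 0 <= u -> 0 < e ->
  exists2 n, (N <= n)%N & `|(vabs (x n - l) `&` u)%O| < e.

(** A common consequence of un-compactness and sequential un-compactness, strong enough for the KB
    property. *)
Definition ball_un_cluster :=
  forall x : X^nat, (forall n, `|x n| <= 1) -> exists2 l, `|l| <= 1 & un_cluster x l.

Lemma un_compact_cluster :
  un_compact (closed_unit_ball X) -> ball_un_cluster.
Proof.
move=> co x x1.
have [|l [l1 lcl]] := co ((x : nat -> un_space X) @ \oo) _.
  by exists 0%N => // n _; exact: x1.
exists l => // u e N u0 e0.
have tail : ((x : nat -> un_space X) @ \oo) [set x n | n in [set n | (N <= n)%N]].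
  by exists N => // n Nn; exists n.
have Vl : nbhs (l : un_space X) [set y | un_V e u (y - l)] by exists (e, u).
by have [_ [[n Nn <-]]] := lcl _ _ tail Vl; exists n.
Qed.

Lemma seq_un_compact_cluster :
  seq_un_compact (closed_unit_ball X) -> ball_un_cluster.
Proof.
move=> co x x1; have [k [kincr [l l1 kl]]] := co x x1.
exists l => // u e N u0 e0.
have /cvgrPdist_lt/(_ e e0)[M _ MP] := kl u u0.
have k_ge n : (n <= k n)%N.
  by elim: n => // n IH; rewrite (leq_ltn_trans IH) // kincr.
exists (k (maxn M N)); first by rewrite (leq_trans _ (k_ge _)) // leq_maxr.
by have := MP (maxn M N) (leq_maxl _ _); rewrite /= sub0r normrN normr_id.
Qed.

Hypothesis H : ball_un_cluster.

Lemma bounded_un_cluster (x : X^nat) (C : R) : 0 < C ->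
  (forall n, `|x n| <= C) -> exists l, un_cluster x l.
Proof.
move=> C0 xC; have C1 : 0 < C^-1 by rewrite invr_gt0.
have [n|l _ lP] := H (x := fun n => C^-1 *: x n).
  by rewrite normrZ gtr0_norm // mulrC ler_pdivrMr // mul1r.
exists (C *: l) => u e N u0 e0.
have [||n Nn nlt] := lP (C^-1 *: u) (C^-1 * e) N.
- by rewrite vscaler_ge0 // ltW.
- by rewrite mulr_gt0.
exists n => //; move: nlt.
rewrite -{1}[l](scalerK (lt0r_neq0 C0)) -scalerBr vabsZ // -vmeetZ //.
by rewrite normrZ gtr0_norm // ltr_pM2l.
Qed.

Lemma un_cluster_nondecreasing (x : X^nat) l :
  nondecreasing_seq x -> un_cluster x l -> forall n, x n <= l.
Proof.
move=> xnd xl k; rewrite -[_ <= _]vsubr_ge0 -voppr_le0 opprB -vpos_eq0.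
(* The test vector is p = (x k - l)^+ itself: for n >= k it lies below |x n - l|, so the meet with p
   is all of p. *)
apply/eqP/norm_eps_eq0 => e e0; set p := vpos _.
have [n kn nlt] := xl p e k (vpos_ge0 _) e0.
apply: (le_trans _ (ltW nlt)); apply: ge0_norm_le; rewrite ?vpos_ge0 // lexI lexx andbT.
apply: le_trans (vpos_le_vabs _); apply: vpos_le; first exact: vpos_ge0.
by apply: le_trans (le_vpos _); rewrite vlerD2r xnd.
Qed.

(** The sequence lies between 0 and its cluster point l, so testing against l measures the full norm
    of l - x n; monotonicity carries smallness at one index to the whole tail. *)
Lemma un_cluster_KB : KB_space X.
Proof.
move=> x x0 xnd [M [_ MP]].
(* [bounded_fun] gives only the bounds strictly above M, and rescaling to the unit ball needs C >
   0. *)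
pose C := Num.max (M + 1) 1.
have C0 : 0 < C by rewrite lt_max ltr01 orbT.
have xC n : `|x n| <= C by apply: MP => //; rewrite lt_max ltrDl ltr01.
have [l xl] := bounded_un_cluster C0 xC.
have le_l := un_cluster_nondecreasing xnd xl.
have l0 : 0 <= l := le_trans (x0 0%N) (le_l 0%N).
apply/cvg_ex; exists l; apply/cvgrPdist_lt => e e0.
have [N _ Nlt] := xl l e 0%N l0 e0.
exists N => // n /= Nn; apply: le_lt_trans Nlt.
have lx m : 0 <= l - x m by rewrite vsubr_ge0.
rewrite vdistC ge0_vabs // meet_l; last exact: vler_wBDr.
by apply: ge0_norm_le => //; apply: vlerD; rewrite ?vlerN2 ?xnd.
Qed.

End un_cluster.

Section subsequences.
Context (R : realType) (X : banachLatticeType R).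
Implicit Types (x y z u v l : X) (e : R).
Hypothesis KB : KB_space X.

Lemma vler_wpMn x y n : x <= y -> x *+ n <= y *+ n.
Proof. by move=> xy; elim: n => // n IH; rewrite !mulrS vlerD. Qed.

Lemma vmeetMn x u n : 0 <= x -> 0 <= u -> (x `&` (u *+ n))%O <= (x `&` u)%O *+ n.
Proof.
move=> x0 u0; elim: n => [|n IH]; first by rewrite leIr.
rewrite !mulrS meetC (le_trans (vmeetDl _ _ _)) ?vmulrn_ge0 //.
by rewrite vlerD // meetC.
Qed.

(** The partial sums of the 2^-(i+1) |x i| increase with norms at most 1, so by the KB property they
    converge to a vector above each term. *)
Lemma common_dominant (x : X^nat) : (forall n, `|x n| <= 1) ->
  exists2 u, 0 <= u & forall n, exists K, vabs (x n) <= u *+ K.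
Proof.
move=> x1; pose s n := \sum_(i < n) (2 ^+ i.+1)^-1 *: vabs (x i).
have p2 i : 0 < (2 ^+ i.+1)^-1 :> R by rewrite invr_gt0 exprn_gt0.
have t0 i : 0 <= (2 ^+ i.+1)^-1 *: vabs (x i).
  by rewrite vscaler_ge0 ?vabs_ge0 // ltW.
have sS n : s n.+1 = s n + (2 ^+ n.+1)^-1 *: vabs (x n) by rewrite /s big_ord_recr.
have s0 n : 0 <= s n.
  by elim: n => [|n IH]; [rewrite /s big_ord0 | rewrite sS vaddr_ge0].
have [//|n|n|u su _] := KB_cvg KB (x := s) (C := 1).
- by rewrite sS vler_wpDr.
- suff : `|s n| <= 1 - (2 ^+ n)^-1.
    by move=> /le_trans; apply; rewrite gerBl invr_ge0 exprn_ge0.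
  elim: n => [|n IH]; first by rewrite /s big_ord0 normr0 expr0 invr1 subrr.
  rewrite sS (le_trans (ler_normD _ _)) //.
  have -> : 1 - (2 ^+ n.+1)^-1 = (1 - (2 ^+ n)^-1) + (2 ^+ n.+1)^-1 :> R.
    by rewrite exprS invfM; lra.
  by rewrite lerD // normrZ gtr0_norm // norm_vabs ler_piMr // ltW.
exists u => [|n]; first exact: le_trans (su 0%N).
exists (2 ^ n.+1)%N; rewrite -scaler_nat natrX.
rewrite -[leLHS](scalerK (lt0r_neq0 (p2 n))) invrK vler_scale2l ?exprn_ge0 //.
by rewrite (le_trans _ (su n.+1)) // sS vler_wpDl.
Qed.

(* A single u that dominates all |x n| and |l| up to scalars tests convergence:
   for any other v, only the limit of v /\ n u matters. *)
Lemma un_cluster_subseq (x : X^nat) l : (forall n, `|x n| <= 1) ->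
  un_cluster x l ->
  exists2 k : nat -> nat, {homo k : m n / (m < n)%N} & un_cvg \oo (x \o k) l.
Proof.
move=> x1 xl; have [u' u'0 xu'] := common_dominant x1.
pose u := u' + vabs l; have u0 : 0 <= u by rewrite vaddr_ge0 ?vabs_ge0.
have xu n : exists K, vabs (x n - l) <= u *+ K.
  have [K xK] := xu' n; exists K.+1.
  rewrite (le_trans (vabsD _ _)) // vabsN mulrSr vlerD //; last exact: vler_wpDl.
  by rewrite (le_trans xK) // vler_wpMn // vler_wpDr ?vabs_ge0.
have /choice[g gP] (p : nat * nat) : exists n, (p.2 < n)%N /\
    `|(vabs (x n - l) `&` u)%O| < p.1.+1%:R^-1.
  have [|n ? ?] := xl u p.1.+1%:R^-1 p.2.+1 u0; first by rewrite invr_gt0.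
  by exists n.
pose k := fix k n := if n is n'.+1 then g (n, k n') else g (0, 0)%N.
have kP n : `|(vabs (x (k n) - l) `&` u)%O| < n.+1%:R^-1.
  by case: n => [|n]; [exact: (gP (0, 0)%N).2 | exact: (gP (n.+1, k n)).2].
exists k => [|v v0].
  by apply: homo_ltn => [|n]; [exact: ltn_trans | exact: (gP (n.+1, k n)).1].
(* Let w be the limit of v /\ m u. Each y = |x (k n) - l| is below a multiple of u, so y /\ v <= w,
   whence y /\ v <= N (y /\ u) + (w - v /\ N u). First N makes the last term small, then n the other
   one. *)
have [n|n|n|w vw wlim] := KB_cvg KB (x := fun n => (v `&` (u *+ n))%O) (C := `|v|).
- by rewrite lexI v0 vmulrn_ge0.
- by rewrite leI2 // mulrSr vler_wpDr.
- by apply: ge0_norm_le; [rewrite lexI v0 vmulrn_ge0 | exact: leIl].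
apply/cvgrPdist_le => e e0.
have e20 : 0 < e / 2 by rewrite divr_gt0.
have [N NP] := wlim _ e20.
(* N may be 0, hence the divisor N + 1. *)
have Ne : 0 < e / 2 / N.+1%:R by rewrite divr_gt0.
have [M MP] := invn_lt Ne.
exists M => // n /= Mn; rewrite sub0r normrN normr_id.
set y := vabs (x (k n) - l); have y0 : 0 <= y by exact: vabs_ge0.
have yvw : (y `&` v)%O <= w.
  have [K yK] := xu (k n); apply: le_trans (vw K).
  by rewrite lexI leIr (le_trans (leIl _ _)).
have w0 : 0 <= w by apply: le_trans yvw; rewrite lexI y0 v0.
have d0 : 0 <= w - (v `&` (u *+ N))%O by rewrite vsubr_ge0.
have : (y `&` v)%O <= (y `&` u)%O *+ N + (w - (v `&` (u *+ N))%O).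
  apply: (@le_trans _ _ (y `&` w)%O); first by rewrite lexI leIl.
  rewrite -[X in (y `&` X)%O](subrK (v `&` (u *+ N))%O) addrC meetC.
  rewrite (le_trans (vmeetDl _ _ _)) ?lexI ?v0 ?vmulrn_ge0 // vlerD ?leIl //.
  rewrite (le_trans _ (vmeetMn _ _ _)) // lexI leIr (le_trans (leIl _ _)) //.
  exact: leIr.
move=> /(ge0_norm_le _) /le_trans; apply; first by rewrite lexI y0 v0.
rewrite (le_trans (ler_normD _ _)) // [e]splitr lerD //; last by rewrite distrC NP.
rewrite normrMn -[leLHS]mulr_natr -[leRHS](divfK (_ : N.+1%:R != 0)) ?pnatr_eq0 //.
apply: (@le_trans _ _ (e / 2 / N.+1%:R * N%:R)).
  by rewrite ler_wpM2r // ltW // (lt_trans (kP n)) // MP.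
by rewrite ler_wpM2l ?ler_nat // ltW.
Qed.

End subsequences.

(** * A dominated Hahn-Banach theorem *)


Section hahn_banach.
Context (R : realType) (V : lmodType R).
Implicit Types (p q : V -> R) (x y v : V) (t c : R).

Definition sublinear p := (forall x y, p (x + y) <= p x + p y) /\
  (forall c x, 0 < c -> p (c *: x) <= c * p x).

Lemma sublinear0 p : sublinear p -> p 0 = 0.
Proof.
move=> [pD pZ]; have := pD 0 0; have := pZ 2^-1 0 (ltac:(by rewrite invr_gt0)).
by rewrite scaler0 addr0; lra.
Qed.

Lemma sublinear_homogeneous p t x : sublinear p -> 0 <= t -> p (t *: x) = t * p x.
Proof.
move=> sp; rewrite le_eqVlt => /predU1P[<-|t0].
  by rewrite scale0r mul0r sublinear0.
apply: le_anti; rewrite sp.2 //= -ler_pdivlMl //.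
by rewrite -{1}[x](scalerK (lt0r_neq0 t0)) sp.2 // invr_gt0.
Qed.

Let reduce_set q y x := [set q (x + t *: y) - t * q y | t in [set t | 0 <= t]].

(** The functional below q that sends -y to at most - q y. At a minimal sublinear q it coincides
    with q, which forces q (- y) = - q y. *)
Definition reduce q y x := inf (reduce_set q y x).

Lemma reduce_has_lbound q y x : sublinear q -> has_lbound (reduce_set q y x).
Proof.
move=> sq; exists (- q (- x)) => _ [t t0 <-].
rewrite -(sublinear_homogeneous _ sq t0).
have := sq.1 (x + t *: y) (- x); rewrite addrAC subrr add0r; lra.
Qed.

Lemma reduce_le q y x t : sublinear q -> 0 <= t ->
  reduce q y x <= q (x + t *: y) - t * q y.
Proof. by move=> sq t0; apply: ge_inf; [exact: reduce_has_lbound | exists t]. Qed.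

Lemma le_reduce q y x c :
  (forall t, 0 <= t -> c <= q (x + t *: y) - t * q y) -> c <= reduce q y x.
Proof.
move=> cq; apply: lb_le_inf => [|_ [t t0 <-]]; last exact: cq.
by exists (q (x + 0 *: y) - 0 * q y), 0 => /=.
Qed.

Lemma reduce_le_id q y x : sublinear q -> reduce q y x <= q x.
Proof.
move=> sq; have := reduce_le y x sq (lexx 0).
by rewrite scale0r addr0 mul0r subr0.
Qed.

Lemma reduceN q y : sublinear q -> reduce q y (- y) <= - q y.
Proof.
move=> sq; have := reduce_le y (- y) sq ler01.
by rewrite scale1r addNr mul1r (sublinear0 sq) sub0r.
Qed.

Lemma reduce_sublinear q y : sublinear q -> sublinear (reduce q y).
Proof.
move=> sq; split=> [x x'|c x c0].
  rewrite -lerBlDr; apply: le_reduce => t t0.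
  rewrite lerBlDr -lerBlDl; apply: le_reduce => s s0.
  rewrite lerBlDl (le_trans (reduce_le y _ sq (addr_ge0 t0 s0))) //.
  rewrite scalerDl addrACA.
  by have := sq.1 (x + t *: y) (x' + s *: y); lra.
rewrite -ler_pdivrMl //; apply: le_reduce => t t0.
rewrite ler_pdivrMl // (le_trans (reduce_le y _ sq (mulr_ge0 (ltW c0) t0))) //.
by rewrite -scalerA -scalerDr mulrBr mulrA lerB // sq.2.
Qed.

(** Zorn's lemma for the reversed pointwise order. A chain is bounded by its pointwise infimum,
    which is finite because q x >= - q (- x) >= - p (- x). *)
Lemma exists_minimal_sublinear p : sublinear p ->
  exists q, [/\ sublinear q, forall x, q x <= p x &
    forall r, sublinear r -> (forall x, r x <= q x) -> r = q].
Proof.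
move=> sp; pose T := {q | sublinear q /\ forall x, q x <= p x}.
pose le_T (q r : T) := `[< forall x, sval r x <= sval q x >].
have [q|r s t /asboolP rs /asboolP st|s t /asboolP st /asboolP ts|
      A Atot|[q [sq qp]] qmax] :=
  @Zorn T le_T.
- exact/asboolP.
- by apply/asboolP => x; exact: le_trans (rs x).
- move: s t st ts => [s Ps] [t Pt] /= st ts.
  have sE : s = t by apply/funext => x; apply: le_anti; rewrite ts st.
  by rewrite sE in Ps *; rewrite (Prop_irrelevance Ps Pt).
- have [->|/set0P[q0 Aq0]] := eqVneq A set0.
    by exists (exist _ p (conj sp (fun x => lexx _))).
  pose E x := [set sval (q : T) x | q in A].
  have Elb x : has_lbound (E x).
    exists (- p (- x)) => _ [[q [sq qp]] _ <-] /=.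
    have := sq.1 x (- x); rewrite subrr (sublinear0 sq).
    by have := qp (- x); lra.
  have infE (q : T) x : A q -> inf (E x) <= sval q x.
    by move=> Aq; apply: ge_inf => //; exists q.
  have leE c x : (forall q : T, A q -> c <= sval q x) -> c <= inf (E x).
    move=> cq; apply: lb_le_inf => [|_ [q Aq <-]]; last exact: cq.
    by exists (sval q0 x), q0.
  suff h : sublinear (fun x => inf (E x)) /\ forall x, inf (E x) <= p x.
    exists (exist _ (fun x => inf (E x)) h : T) => q Aq.
    by apply/asboolP => x; exact: infE.
  split; last by move=> x; apply: le_trans (infE _ _ Aq0) _; exact: (svalP q0).2.
  split=> [x y|c x c0].
    rewrite -lerBlDr; apply/leE => q Aq; rewrite lerBlDr -lerBlDl.
    apply/leE => r Ar; rewrite lerBlDl.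
    (* The smaller of the two chain members serves both arguments. *)
    have [/asboolP qr|/asboolP rq] := Atot _ _ Aq Ar.
      rewrite (le_trans (infE _ _ Ar)) // (le_trans ((svalP r).1.1 _ _)) //.
      by rewrite lerD2r.
    rewrite (le_trans (infE _ _ Aq)) // (le_trans ((svalP q).1.1 _ _)) //.
    by rewrite lerD2l.
  rewrite -ler_pdivrMl //; apply/leE => q Aq.
  by rewrite ler_pdivrMl // (le_trans (infE _ _ Aq)) // (svalP q).1.2.
exists q; split=> // r sr rq.
have h : sublinear r /\ forall x, r x <= p x.
  by split=> // x; exact: le_trans (qp x).
by have /(congr1 sval) := qmax (exist _ r h) (asboolT rq).
Qed.

(** Minimality makes f odd, and an odd subadditive map is additive. Minimizing below [reduce p v]
    instead of p adds f (- v) <= - p v, that is f v >= p v. *)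
Lemma hahn_banach_dominated p v : sublinear p ->
  exists f : V -> R, [/\ forall x y, f (x + y) = f x + f y,
    forall x, f x <= p x & f v = p v].
Proof.
move=> sp; have [f [sf fp fmin]] := exists_minimal_sublinear (reduce_sublinear v sp).
have fN x : f (- x) = - f x.
  have := fmin _ (reduce_sublinear x sf) (fun y => reduce_le_id x y sf).
  move=> fE; have := reduceN x sf; rewrite fE => fNx.
  have := sf.1 x (- x); rewrite subrr (sublinear0 sf) => ?.
  by apply: le_anti; rewrite fNx /=; lra.
have fp' x : f x <= p x by apply: le_trans (fp x) _; exact: reduce_le_id.
exists f; split=> // [x y|].
  apply: le_anti; rewrite sf.1 /=.
  by have := sf.1 (x + y) (- y); rewrite addrK fN; lra.
apply: le_anti; rewrite fp' /=.
by have := le_trans (fp (- v)) (reduceN v sp); rewrite fN lerN2.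
Qed.

End hahn_banach.

(** * Components and splitting *)


Section components.
Context (R : realType) (X : banachLatticeType R).
Implicit Types (Q a h p x y z u v : X) (e : R).

Definition component Q h := (h `&` (Q - h))%O = 0.

Lemma component_ge0 Q h : component Q h -> 0 <= h.
Proof. by move=> hQ; rewrite -[leLHS]hQ leIl. Qed.

Lemma component_le Q h : component Q h -> h <= Q.
Proof. by move=> hQ; rewrite -vsubr_ge0 -[leLHS]hQ leIr. Qed.

Lemma componentC Q h : component Q h -> component Q (Q - h).
Proof. by rewrite /component opprB addrCA subrr addr0 meetC. Qed.

Lemma component0 Q : 0 <= Q -> component Q 0.
Proof. by move=> Q0; rewrite /component subr0; apply/meet_idPl. Qed.

Lemma component_id Q : 0 <= Q -> component Q Q.
Proof. by move=> /component0/componentC; rewrite subr0. Qed.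

Lemma vdist_le x y u : 0 <= x -> 0 <= y -> x <= u -> y <= u -> vabs (x - y) <= u.
Proof. by move=> x0 y0 xu yu; rewrite vabs_le opprB !vler_wBDr. Qed.

(** Q - h = (Q - a) + (a - h), and both summands are disjoint from h. *)
Lemma component_trans Q a h : component Q a -> component a h -> component Q h.
Proof.
move=> Qa ah; have h0 := component_ge0 ah; have ha := component_le ah.
have a0 := component_ge0 Qa; have aQ := component_le Qa.
rewrite /component -(subrKA a) meetC meet0D ?vsubr_ge0 //; last by rewrite meetC.
by rewrite meetC; apply: meet0_le Qa; rewrite ?vsubr_ge0.
Qed.

Lemma component_meet Q a h : component Q a -> component Q h -> component a (h `&` a)%O.
Proof.
move=> Qa Qh; rewrite /component [(h `&` a)%O]meetC vsubrI.
have h0 := component_ge0 Qh; have a0 := component_ge0 Qa.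
have hQ := component_le Qh; have aQ := component_le Qa.
apply: meet0_le Qh; rewrite ?lexI ?a0 ?h0 ?vpos_ge0 ?leIr //.
by apply: vpos_le; rewrite ?vsubr_ge0 // vlerD2r.
Qed.

(** Meets are 1-Lipschitz in each argument, so the components of Q form a norm closed set. *)
Lemma component_norm_approx Q h :
  (forall e, 0 < e -> exists2 h', component Q h' & `|h' - h| <= e) ->
  component Q h.
Proof.
move=> hQ; apply: norm_eps_eq0 => e e0.
have [|h' h'Q h'h] := hQ (e / 2); first by rewrite divr_gt0.
rewrite -[X in `|X|]subr0 -h'Q -(subrKA (h' `&` (Q - h))%O) [e]splitr.
rewrite (le_trans (ler_normD _ _)) // lerD //.
  by rewrite (le_trans (norm_meet_le _ _ _)) // distrC.
rewrite ![(h' `&` _)%O]meetC (le_trans (norm_meet_le _ _ _)) //.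
by rewrite opprB addrC subrKA.
Qed.

(* p is the projection of a onto the band of y, the limit of a /\ n y. *)
Lemma exists_band_component a y : KB_space X -> 0 <= a -> 0 <= y ->
  exists p, [/\ component a p, (a `&` y)%O <= p &
    forall z, 0 <= z -> (z `&` y)%O = 0 -> (z `&` p)%O = 0].
Proof.
move=> KB a0 y0.
have s0 n : 0 <= (a `&` (y *+ n))%O by rewrite lexI a0 vmulrn_ge0.
have [//|n|n|p sp lim] := KB_cvg KB (x := fun n => (a `&` (y *+ n))%O) (C := `|a|).
- by rewrite leI2 // mulrSr vler_wpDr.
- by apply: ge0_norm_le => //; exact: leIl.
have p0 : 0 <= p := le_trans (s0 0%N) (sp 0%N).
have ap : p <= a.
  rewrite -vsubr_ge0; apply: ge0_norm_approx => e /lim[N NP].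
  exists (a - (a `&` (y *+ N))%O); first by rewrite vsubr_ge0 leIl.
  by rewrite opprB addrC subrKA distrC NP.
have disj z : 0 <= z -> (z `&` y)%O = 0 -> (z `&` p)%O = 0.
  move=> z0 zy; apply: norm_eps_eq0 => e /lim[N /(_ N (leqnn N)) NP].
  apply: le_trans NP; rewrite distrC -[X in `|X|]subr0.
  have <- : ((a `&` (y *+ N)) `&` z)%O = 0.
    apply: (@meet0_le _ _ (y *+ N) z); rewrite ?s0 ?leIr //.
    by rewrite meet0Mn // meetC.
  by rewrite [(z `&` p)%O]meetC norm_meet_le.
exists p; split=> //; last by have := sp 1%N; rewrite mulr1n.
rewrite /component meetC; apply: disj; rewrite ?vsubr_ge0 //.
(* w + (a /\ N y) lies below both a and (N + 1) y, hence below p; in the limit w + p <= p. *)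
set w := ((a - p) `&` y)%O.
have w0 : 0 <= w by rewrite lexI vsubr_ge0 ap y0.
apply: le_anti; rewrite w0 andbT -(vlerD2r p) add0r -vsubr_ge0.
apply: ge0_norm_approx => e /lim[N NP].
exists (p - (w + (a `&` (y *+ N))%O)).
  rewrite vsubr_ge0 (le_trans _ (sp N.+1)) // lexI; apply/andP; split.
    by rewrite -vlerBrDr (le_trans (leIl _ _)) // vlerD // vlerN2.
  by rewrite mulrS vlerD ?leIr.
rewrite opprB addrC subrKA distrC opprD addrACA subrr add0r.
exact: NP.
Qed.

(** The order form of an atom, suited to splitting arguments; [indecomposable_atom] leads back to
    principal ideals. *)
Definition indecomposable a := [/\ 0 <= a, a != 0 &
  forall y z, 0 <= y -> 0 <= z -> y <= a -> z <= a -> (y `&` z)%O = 0 ->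
    y = 0 \/ z = 0].

(** Domination by the sublinear map x |-> ||x^+|| yields positivity as well: f (- x) <= ||(- x)^+||
    = 0 for x >= 0. *)
Lemma positive_functional v : 0 <= v -> exists f : X -> R,
  [/\ forall x y, f (x + y) = f x + f y, forall x, 0 <= x -> 0 <= f x,
    forall x, f x <= `|x| & f v = `|v|].
Proof.
move=> v0; have sp : @sublinear R X (fun x => `|vpos x|).
  split=> [x y|c x c0].
    apply: le_trans (ler_normD _ _); apply: ge0_norm_le; first exact: vpos_ge0.
    by apply: vpos_le; rewrite ?vaddr_ge0 ?vpos_ge0 // vlerD ?le_vpos.
  rewrite -[c in leRHS]gtr0_norm // -normrZ; apply: ge0_norm_le; first exact: vpos_ge0.
  have c0' := ltW c0; apply: vpos_le; first by rewrite vscaler_ge0 ?vpos_ge0.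
  by rewrite vler_scale2l ?le_vpos.
have [f [fD fp fv]] := hahn_banach_dominated v sp.
have f0 : f 0 = 0 by have := fD 0 0; rewrite addr0; lra.
exists f; split=> // [x x0|x|]; last by rewrite fv vposE.
  have := fp (- x); have /eqP -> : vpos (- x) == 0 by rewrite vpos_eq0 voppr_le0.
  by rewrite normr0; have := fD x (- x); rewrite subrr f0; lra.
apply: le_trans (fp x) _; rewrite -[leRHS]norm_vabs.
by apply: ge0_norm_le; [exact: vpos_ge0 | exact: vpos_le_vabs].
Qed.

Section splitting.
Hypothesis KB : KB_space X.
Variable f : X -> R.
Hypotheses (fD : forall x y, f (x + y) = f x + f y)
  (f_ge0 : forall x, 0 <= x -> 0 <= f x) (f_le : forall x, f x <= `|x|).

Let fB x y : f (x - y) = f x - f y.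
Proof. by have := fD (x - y) y; rewrite subrK; lra. Qed.

Let large Q h := component Q h /\ f Q / 2 <= f h.

(** A greedy descent: b achieves at least half of the largest possible distance below a. The
    existential stands outside the implication so that [choice] gives a total function to
    iterate. *)
Let minimizing_step Q a : exists b, large Q a ->
  [/\ large Q b, b <= a &
    forall h, large Q h -> h <= a -> `|a - h| <= 2 * `|a - b|].
Proof.
have [la|] := pselect (large Q a); last by exists a.
pose S := [set `|a - h| | h in [set h | large Q h /\ h <= a]].
have a0 := component_ge0 la.1.
have ubS : ubound S `|a|.
  move=> _ [h [lh ha] <-]; apply: ge0_norm_le; first by rewrite vsubr_ge0.
  by apply: vler_wBDr => //; exact: component_ge0 lh.1.
have Sle h : large Q h -> h <= a -> `|a - h| <= sup S.
  by move=> lh ha; apply: ub_le_sup; [exists `|a| | exists h].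
have supS : has_sup S by split; [exists `|a - a|, a | exists `|a|].
have : 0 <= sup S by have := Sle a la (lexx a); rewrite subrr normr0.
rewrite le_eqVlt => /predU1P[S0|S0].
  exists a => _; split=> // h lh ha; rewrite (le_trans (Sle h lh ha)) // -S0.
  by rewrite mulr_ge0.
have [|_ [b [lb ba] <-] ltb] := @sup_adherent R S (sup S / 2) _ supS.
  by rewrite divr_gt0.
exists b => _; split=> // h lh ha; rewrite (le_trans (Sle h lh ha)) //.
by lra.
Qed.

(** The greedy iterates decrease to a limit a, again large. A large h <= a is within twice the step
    length of each iterate, and the steps tend to 0. *)
Lemma exists_minimal_large Q : 0 <= Q ->
  exists a, large Q a /\ forall h, large Q h -> h <= a -> h = a.
Proof.
move=> Q0; have /choice[g gP] := minimizing_step Q.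
pose s n := iter n g Q.
have ls n : large Q (s n).
  elim: n => [|n IH]; last by have [] := gP _ IH.
  split; first exact: component_id.
  by have := f_ge0 Q0; rewrite /=; lra.
have s0 n : 0 <= s n := component_ge0 (ls n).1.
have [n|a [a0 sa lim]] := KB_cvg_decr KB s0; first by have [] := gP _ (ls n).
have la : large Q a.
  split.
    apply: component_norm_approx => e /lim[N /(_ N (leqnn N)) NP].
    by exists (s N) => //; exact: (ls N).1.
  apply/ler_addgt0Pr => e /lim[N /(_ N (leqnn N)) NP].
  rewrite (le_trans (ls N).2) // -lerBlDl -fB; exact: le_trans (f_le _) NP.
exists a; split=> // h lh ha; apply/eqP; rewrite eq_sym -subr_eq0; apply/eqP.
apply: norm_eps_eq0 => e e0.
have [|N NP] := lim (e / 4); first by rewrite divr_gt0.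
have [_ _ /(_ h lh (le_trans ha (sa N))) sh] := gP _ (ls N).
apply: (@le_trans _ _ `|s N - h|).
  by apply: ge0_norm_le; rewrite ?vsubr_ge0 // vlerD2r.
apply: (le_trans sh).
have : `|s N - g (s N)| <= e / 4 + e / 4.
  rewrite -(subrKA a) (le_trans (ler_normD _ _)) // lerD // ?NP //.
  by rewrite distrC (NP N.+1).
lra.
Qed.

Lemma exists_splitting Q : 0 <= Q ->
  (forall a, indecomposable a -> ~ a <= Q) ->
  exists h, [/\ component Q h, f Q / 3 <= f h & f Q / 3 <= f (Q - h)].
Proof.
move=> Q0 nind; have [fQ0|fQ0] := eqVneq (f Q) 0.
  exists 0; rewrite subr0 fQ0 mul0r; split=> //; first exact: component0.
  exact: f_ge0.
have fQ : 0 < f Q by rewrite lt_def fQ0 f_ge0.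
apply: contrapT => nsplit.
(* Without a splitting, no component has mass between one and two thirds of f Q. *)
have dich h : component Q h -> f Q / 3 <= f h -> f Q * 2 / 3 < f h.
  move=> hQ hf; rewrite ltNge; apply/negP => hle.
  by apply: nsplit; exists h; split=> //; rewrite fB; lra.
have dich_large h : component Q h -> f Q / 3 <= f h -> large Q h.
  by move=> hQ hf; split=> //; have := dich _ hQ hf; lra.
have [a [la amin]] := exists_minimal_large Q0.
have a0 := component_ge0 la.1.
apply: (nind a); last exact: component_le la.1.
split=> // [|y z y0 z0 ya za yz].
  apply/eqP => a00; have := la.2; have := fD 0 0.
  by rewrite a00 addr0; lra.
(* p is the part of a in the band of y. One of p and a - p is large, hence equals a by minimality:
   the former kills z, the latter y. *)
have [p [ap yp zp]] := exists_band_component KB a0 y0.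
have Qp := component_trans la.1 ap.
have Qap := component_trans la.1 (componentC ap).
have pa := component_le ap; have p0 := component_ge0 ap.
have : f Q / 3 <= f p \/ f Q / 3 <= f (a - p).
  have [//|pl] := leP (f Q / 3) (f p); first by left.
  have : f Q * 2 / 3 < f a by apply: dich; [exact: la.1 | have := la.2; lra].
  by right; rewrite fB; lra.
case=> [/(dich_large _ Qp) lp|/(dich_large _ Qap) lap].
  right; have pE := amin p lp pa.
  have <- : (z `&` p)%O = 0 by apply: zp => //; rewrite meetC.
  by apply/esym/meet_idPl; rewrite pE.
left; have : a - p = a by apply: amin => //; exact: vler_wBDr.
move=> /eqP; rewrite -subr_eq0 addrAC subrr add0r oppr_eq0 => /eqP pE.
by apply: le_anti; rewrite y0 andbT -pE (le_trans _ yp) // lexI ya lexx.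
Qed.

(* Split Q along the first element e of E into e and Q - e, and glue the two
   solutions for the rest of E. *)
Lemma exists_far_component (E : seq X) Q : 0 <= Q ->
  (forall a, indecomposable a -> ~ a <= Q) ->
  (forall x, x \in E -> component Q x) ->
  exists h, [/\ component Q h, f Q / 3 <= f h, f Q / 3 <= f (Q - h) &
    forall x, x \in E -> f Q / 3 <= f (vabs (h - x))].
Proof.
move sE : (size E) => n.
elim: n E sE Q => [|n IH] [|e E] //= => [_|[sE]] Q Q0 nind EQ.
  by have [h [? ? ?]] := exists_splitting Q0 nind; exists h; split.
have Qe : component Q e by apply: EQ; rewrite mem_head.
have Qe' := componentC Qe.
have EQ' x : x \in E -> component Q x by move=> xE; apply: EQ; rewrite in_cons xE orbT.
have sub a : component Q a -> exists h, [/\ component a h, f a / 3 <= f h,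
    f a / 3 <= f (a - h) & forall x, x \in [seq (y `&` a)%O | y <- E] ->
      f a / 3 <= f (vabs (h - x))].
  move=> Qa; apply: IH; [by rewrite size_map | exact: component_ge0 Qa | |].
    by move=> b ib ba; apply: (nind b) => //; exact: le_trans (component_le Qa).
  by move=> _ /mapP[x xE ->]; apply: component_meet Qa _; exact: EQ'.
have [h [eh hf hf' hE]] := sub _ Qe.
have [k [ek kf kf' kE]] := sub _ Qe'.
have e0 := component_ge0 Qe; have e'0 := component_ge0 Qe'.
have h0 := component_ge0 eh; have k0 := component_ge0 ek.
have he := component_le eh; have ke := component_le ek.
have QE : Q = e + (Q - e) by rewrite addrCA subrr addr0.
have QfE : f Q = f e + f (Q - e) by rewrite -fD -QE.
have hkE : Q - (h + k) = (e - h) + ((Q - e) - k) by rewrite {1}QE opprD addrACA.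
exists (h + k); split.
- rewrite /component hkE.
  have eh0 : 0 <= e - h by rewrite vsubr_ge0.
  have ek0 : 0 <= Q - e - k by rewrite vsubr_ge0.
  have ehe : e - h <= e by exact: vler_wBDr.
  have eke : Q - e - k <= Q - e by exact: vler_wBDr.
  have hd : (h `&` (Q - e - k))%O = 0 by apply: meet0_le Qe.
  have kc : (k `&` (e - h))%O = 0.
    by rewrite meetC; apply: meet0_le Qe.
  by apply: meet0D; rewrite ?(vaddr_ge0 eh0 ek0) // meetC; apply: meet0D => //; rewrite meetC.
- by rewrite fD QfE; lra.
- by rewrite hkE fD QfE; lra.
(* For x = e the modulus |h + k - e| is (e - h) + k, and each summand has a third of the mass of its
   part. *)
move=> x; rewrite in_cons => /predU1P[->|xE].
  apply: (@le_trans _ _ (f ((e - h) + k))); first by rewrite fD QfE; lra.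
  have -> : h + k - e = k + (h - e) by rewrite addrAC addrC.
  rewrite vabsD_disjoint vdistC !ge0_vabs ?vsubr_ge0 //; last first.
    by rewrite meetC; apply: meet0_le Qe; rewrite ?vsubr_ge0 // vler_wBDr.
  by rewrite addrC.
have xe : component Q x by exact: EQ'.
(* Cut along e and Q - e, the difference h + k - x has two disjoint pieces, so its modulus is the
   sum of theirs and the induction hypotheses add up. *)
have xE' : x = (x `&` e)%O + (x `&` (Q - e))%O.
  rewrite -meetD_disjoint // -?QE; last exact: component_ge0 xe.
  by apply/esym/meet_idPl; exact: component_le.
rewrite {1}xE' opprD addrACA vabsD_disjoint.
  rewrite fD QfE mulrDl lerD //.
    by apply: hE; apply/mapP; exists x.
  by apply: kE; apply/mapP; exists x.
have x0 := component_ge0 xe.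
by apply: meet0_le Qe; rewrite ?vabs_ge0 // vdist_le // ?lexI ?x0 ?e0 ?e'0 ?leIr.
Qed.

End splitting.
End components.

(** * Existence of atoms *)


Section atoms.
Context (R : realType) (X : banachLatticeType R).
Implicit Types (a b h p x y z u v : X) (e t c : R).

Lemma seq_un_compact_indecomposable v : KB_space X ->
  seq_un_compact (closed_unit_ball X) -> 0 <= v -> v != 0 ->
  exists2 a, indecomposable a & a <= v.
Proof.
move=> KB co v0 vn0; apply: contrapT => nind.
have [f [fD f0 fle fv]] := positive_functional v0.
have nind' a : indecomposable a -> ~ a <= v by move=> ia av; apply: nind; exists a.
have nv : 0 < `|v| by rewrite normr_gt0.
have nv1 : 0 < `|v|^-1 by rewrite invr_gt0.
(* [g] will be fed the list of components found so far; 0 is a dummy value for lists with other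
   entries. *)
have /choice[g gP] (E : seq X) : exists h, (forall x, x \in E -> component v x) ->
    component v h /\ forall x, x \in E -> f v / 3 <= f (vabs (h - x)).
  have [EQ|] := pselect (forall x, x \in E -> component v x); last by exists 0.
  by have [h [? _ _ ?]] := exists_far_component KB fD f0 fle v0 nind' EQ; exists h.
pose L n := iter n (fun E => g E :: E) [::].
have LP n : forall x, x \in L n -> component v x.
  elim: n => // n IH x; rewrite in_cons => /predU1P[->|]; last exact: IH.
  exact: (gP _ IH).1.
pose w n := g (L n).
have wv n : component v (w n) by exact: (gP _ (LP n)).1.
have wL m n : (m < n)%N -> w m \in L n.
  elim: n => // n IH; rewrite ltnS leq_eqVlt in_cons => /predU1P[->|/IH ->].
    by rewrite eqxx.
  by rewrite orbT.
have wfar m n : (m < n)%N -> `|v| / 3 <= `|w n - w m|.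
  move=> mn; rewrite -fv -norm_vabs; apply: le_trans (fle _).
  exact: (gP _ (LP n)).2 _ (wL _ _ mn).
have w0 n := component_ge0 (wv n); have w_le n := component_le (wv n).
pose s n := `|v|^-1 *: w n.
have s1 n : closed_unit_ball X (s n).
  rewrite /closed_unit_ball /= normrZ gtr0_norm // mulrC ler_pdivrMr // mul1r.
  exact: ge0_norm_le.
have [k [kincr [l _ kl]]] := co s s1.
(* All |s m - s n| lie below u, so the meet with u loses nothing: two terms un-close to l within 1/6
   are less than 1/3 apart in norm, against [wfar]. *)
pose u := `|v|^-1 *: v; have u0 : 0 <= u by rewrite vscaler_ge0 // ltW.
have /cvgrPdist_lt/(_ 6^-1)[|N _ NP] := kl u u0; first by rewrite invr_gt0.
have := NP N (leqnn N); have := NP N.+1 (leqnSn N).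
rewrite /= !sub0r !normrN !normr_id => lt1 lt2.
have : `|v| / 3 <= `|w (k N.+1) - w (k N)| by apply: wfar; exact: kincr.
have : `|s (k N.+1) - s (k N)| = `|v|^-1 * `|w (k N.+1) - w (k N)|.
  by rewrite -scalerBr normrZ gtr0_norm.
have : `|s (k N.+1) - s (k N)| < 6^-1 + 6^-1.
  apply: le_lt_trans (ltrD lt1 lt2); apply: le_trans (ler_normD _ _).
  apply: vabs_le_norm; apply: le_trans (vmeetDl _ _ u0); rewrite ?vabs_ge0 //.
  rewrite lexI -{1}(subrKA l) [vabs (s (k N) - l)]vdistC vabsD /=.
  by rewrite -scalerBr vabsZ // vler_scale2l ?vdist_le // ltW.
move=> lt sE le3; move: lt; rewrite sE ltNge => /negP; apply.
by rewrite ler_pdivlMl //; lra.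
Qed.

(** The positive and negative parts of x - t a are disjoint and below a for t in [0, 1], so one
    vanishes and x is comparable with t a. The coefficient is the supremum of the t with t a <=
    x. *)
Lemma indecomposable_multiple a x : indecomposable a -> 0 <= x -> x <= a ->
  exists c, x = c *: a.
Proof.
move=> [a0 an0 ind] x0 xa.
have na : 0 < `|a| by rewrite normr_gt0.
have dich t : 0 <= t <= 1 -> t *: a <= x \/ x <= t *: a.
  move=> /andP[t0 t1].
  have ta : t *: a <= a by rewrite -[leRHS]scale1r vler_scale2r.
  have ta0 : 0 <= t *: a by exact: vscaler_ge0.
  have := ind _ _ (vpos_ge0 (x - t *: a)) (vpos_ge0 (- (x - t *: a))).
  rewrite vpos_meetN opprB => /(_ _ _ erefl)[||/eqP|/eqP].
  - by apply: vpos_le => //; exact: vler_wBDr.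
  - by apply: vpos_le => //; exact: vler_wBDr.
  - by rewrite vpos_eq0 vlerBlDr add0r; right.
  - by rewrite vpos_eq0 vlerBlDr add0r; left.
pose S := [set t | (0 <= t <= 1) /\ t *: a <= x].
have S0 : S 0 by rewrite /S /= lexx ler01 scale0r.
have ubS : ubound S 1 by move=> t [/andP[]].
have supS : has_sup S by split; [exists 0 | exists 1].
have c0 : 0 <= sup S by apply: ub_le_sup => //; exists 1.
have c1 : sup S <= 1 by apply: sup_le_ub => //; exists 0.
have ea e : 0 < e -> 0 < e / `|a| by move=> e0; rewrite divr_gt0.
exists (sup S); apply: le_anti; apply/andP; split.
  apply: le_norm_approx => e e0.
  have [d0|d0] := eqVneq (sup S) 1.
    by exists a => //; rewrite d0 scale1r subrr normr0 ltW.
  have clt : sup S < 1 by rewrite lt_neqAle d0.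
  pose t := Num.min 1 (sup S + e / `|a|).
  have ct : sup S < t by rewrite lt_min clt ltrDl ea.
  have t01 : 0 <= t <= 1 by rewrite (le_trans c0 (ltW ct)) ge_min lexx.
  exists (t *: a).
    have [ta|//] := dich t t01.
    by have := ub_le_sup (ex_intro _ 1 ubS) (conj t01 ta : S t); rewrite leNgt ct.
  rewrite -scalerBl normrZ gtr0_norm ?subr_gt0 // -ler_pdivlMr // lerBlDl.
  by rewrite ge_min lexx orbT.
rewrite -vsubr_ge0; apply: ge0_norm_approx => e e0.
have [t [t01 ta] tlt] := sup_adherent (ea e e0) supS.
exists (x - t *: a); first by rewrite vsubr_ge0.
rewrite opprB addrC subrKA -scalerBl normrZ -ler_pdivlMr // ger0_norm.
  by rewrite lerBlDr -lerBlDl ltW.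
by rewrite subr_ge0; apply: ub_le_sup; [exists 1 | split].
Qed.

(** The multiples of a already form an order ideal: both parts of a vector dominated by one of them
    rescale into [0, a]. *)
Lemma indecomposable_atom a : indecomposable a -> atom a.
Proof.
move=> ia; have [a0 an0 _] := ia; split=> //; apply/seteqP; split=> [x|_ [c _ <-]].
  apply; split; last by move=> _ ->; exists 1; rewrite // scale1r.
  split=> [|_ _ [c _ <-] [d _ <-]|c _ [d _ <-]|y _ [c _ <-]].
  - by exists 0; rewrite // scale0r.
  - by exists (c + d); rewrite // scalerDl.
  - by exists (c * d); rewrite // scalerA.
  move=> yc; have {}yc : vabs y <= `|c| *: a.
    apply: le_trans yc _; rewrite vabs_le -scaleNr.
    by rewrite !vler_scale2r // ?ler_norm // -normrN ler_norm.
  have mult z : 0 <= z -> z <= vabs y -> exists d, z = d *: a.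
    move=> z0 zy; have {}zy := le_trans zy yc.
    (* Adding 1 keeps the scaling factor invertible when c = 0. *)
    have d0 : 0 < `|c| + 1 by rewrite ltr_wpDl.
    have d1 : 0 < (`|c| + 1)^-1 by rewrite invr_gt0.
    have [||d dE] := @indecomposable_multiple a ((`|c| + 1)^-1 *: z) ia.
    - by rewrite vscaler_ge0 // ltW.
    - rewrite -[leRHS](scalerK (lt0r_neq0 d0)); apply: vler_scale2l; first exact: ltW.
      by rewrite (le_trans zy) // vler_scale2r // lerDl.
    by exists ((`|c| + 1) * d); rewrite -scalerA -dE scalerKV // lt0r_neq0.
  have [d1 d1E] := mult _ (vpos_ge0 y) (vpos_le_vabs y).
  have [|d2 d2E] := mult _ (vpos_ge0 (- y)); first by rewrite -(vabsN y) vpos_le_vabs.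
  by exists (d1 - d2); rewrite // scalerBl -d1E -d2E vpos_subN.
by move=> I [[_ _ IZ _] aI]; apply: IZ; exact: aI.
Qed.

(** For a band B containing the atoms, x >= 0 is the supremum of A, the part of B in [0, x]. If an
    upper bound z of A were not above x, an atom a would lie below x - x /\ z; since A is below x /\
    z, it would be stable under adding a, so n a <= x for all n. *)
Lemma seq_un_compact_atomic : KB_space X ->
  seq_un_compact (closed_unit_ball X) -> atomic X.
Proof.
move=> KB co; apply/seteqP; split=> // x _ B [Bband Batom].
have [[B0 BD BZ Bsolid] Bsup] := Bband.
apply: (Bsolid _ (vabs x)); last by rewrite vabs_vabs.
have x0 := vabs_ge0 x; move: (vabs x) x0 => {}x x0.
pose A := [set y | B y /\ 0 <= y <= x].
apply: (Bsup A) => [y []//|]; split=> [y [_ /andP[]]//|z zA].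
pose d := x - (x `&` z)%O; have d0 : 0 <= d by rewrite vsubr_ge0 leIl.
have [dE|dn0] := eqVneq d 0.
  by have := leIr z x; move/eqP: dE; rewrite subr_eq0 => /eqP <-.
have [a ia ad] := seq_un_compact_indecomposable KB co d0 dn0.
have [a0 an0 _] := ia.
have Ba : B a by apply: Batom; exact: indecomposable_atom.
have Aa n : A (a *+ n).
  elim: n => [|n [By /andP[y0 yx]]]; first by split; rewrite ?lexx.
  rewrite mulrSr; split; first exact: BD.
  rewrite vaddr_ge0 //= -(subrK (x `&` z)%O x) addrC vlerD //.
  by rewrite lexI yx zA //; split=> //; rewrite y0.
by move/eqP: an0; case; apply: (@varchimedean _ _ a x) => // n; have [_ /andP[]] := Aa n.
Qed.

End atoms.

(** * Ultrafilters in atomic KB-spaces *)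


Section bands.
Context (R : realType) (X : banachLatticeType R).
Implicit Types (a b x y z u v s l : X) (e c : R).

Lemma vabs_scale c x : vabs (c *: x) = `|c| *: vabs x.
Proof.
have [c0|c0|->] := ltgtP c 0; last by rewrite !scale0r normr0 scale0r vabs0.
  by rewrite ltr0_norm // -vabsN -scaleNr vabsZ ?oppr_gt0.
by rewrite gtr0_norm // vabsZ.
Qed.

Lemma vabs_dist_le x y : vabs (vabs x - vabs y) <= vabs (x - y).
Proof.
have main p q : vabs p - vabs q <= vabs (p - q).
  by rewrite vlerBlDr -{1}[p](subrK q) vabsD.
by rewrite vabs_le main opprB vdistC main.
Qed.

(** Turns norm convergence of truncations into un-convergence. For p = x - y the claim is |p| /\ u
    <= |p /\ u|: truncation does not shrink the negative part, and p^+ /\ u is below (p /\ u)^+ +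
    p^- but disjoint from p^-. *)
Lemma vabs_meet_truncate x y u : 0 <= u ->
  (vabs (x - y) `&` u)%O <= vabs ((x `&` (y + u))%O - y).
Proof.
move=> u0; set p := x - y.
have -> : (x `&` (y + u))%O - y = (p `&` u)%O.
  by rewrite vmeetDr [y + u]addrC addrK.
rewrite -vpos_addN -[leRHS]vpos_addN.
apply: le_trans (vmeetDl (vpos_ge0 _) (vpos_ge0 _) u0) _; apply: vlerD; last first.
  apply: le_trans (leIl _ _) _; apply: vpos_le; first exact: vpos_ge0.
  by apply: le_trans (le_vpos _); rewrite vlerN2 leIl.
set m := (vpos p `&` u)%O.
have m0 : 0 <= m by rewrite lexI vpos_ge0 u0.
have mle : m <= vpos (p `&` u)%O + vpos (- p).
  apply: (@le_trans _ _ ((p `&` u)%O + vpos (- p))); last first.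
    by rewrite vlerD2r le_vpos.
  by rewrite /m (vposD p) vmeetDr leI2 // vler_wpDr ?vpos_ge0.
have : m <= (vpos (p `&` u)%O `&` m)%O + (vpos (- p) `&` m)%O.
  by apply: le_trans (vmeetDl (vpos_ge0 _) (vpos_ge0 _) m0); rewrite lexI mle lexx.
have -> : (vpos (- p) `&` m)%O = 0.
  by rewrite meetC; apply: meet0_le (vpos_meetN p); rewrite ?vpos_ge0 ?leIl.
by rewrite addr0 => /le_trans; apply; exact: leIl.
Qed.

(** Fix a in A and z = x - a. The part of J in [0, z] is directed, so it has a norm limit l, in J by
    closedness. It contains (b - a)^+ for b in A, whence z <= l and solidity applies. *)
Lemma closed_ideal_band (J : set X) : KB_space X -> order_ideal J ->
  (forall x, (forall e, 0 < e -> exists2 y, J y & `|y - x| <= e) -> J x) ->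
  band J.
Proof.
move=> KB idJ clJ; split=> // A x AJ [ubx lubx]; have [J0 JD JZ Jsolid] := idJ.
have [A0|/set0P[a Aa]] := eqVneq A set0.
  have xle z : x <= z by apply: lubx; rewrite A0.
  suff -> : x = 0 by [].
  by apply: le_anti; rewrite xle /= -(vlerD2r x) add0r xle.
pose z := x - a; have z0 : 0 <= z by rewrite vsubr_ge0; exact: ubx.
pose D := [set y | J y /\ 0 <= y <= z].
have JN y : J y -> J (- y) by rewrite -scaleN1r; exact: JZ.
have Jabs y : J y -> J (vabs y) by move=> /Jsolid; apply; rewrite vabs_vabs.
have Jpos y : J y -> J (vpos y).
  by move=> /Jsolid; apply; rewrite ge0_vabs ?vpos_ge0 ?vpos_le_vabs.
have [|y [_ /andP[]]//|y [_ /andP[y0 yz]]|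
      y y' [Jy /andP[y0 yz]] [Jy' /andP[y'0 y'z]]|l lD lim] :=
    @KB_directed R X KB D `|z|.
- by exists 0; split; rewrite ?lexx.
- exact: ge0_norm_le.
- exists (y `|` y')%O; split; rewrite ?leUl ?leUr //; split.
    apply: (Jsolid _ (y + y')); first exact: JD.
    rewrite !ge0_vabs ?vaddr_ge0 //; last by rewrite (le_trans y0) ?leUl.
    by rewrite leUx vler_wpDr // vler_wpDl.
  by rewrite leUx yz y'z (le_trans y0) ?leUl.
have Jl : J l.
  apply: clJ => e /lim[b [Jb Db] bP]; exists b => //.
  by apply: bP => //; split.
have zl : z <= l.
  rewrite /z vlerBlDr; apply: lubx => b Ab.
  rewrite -vlerBlDr; apply: le_trans (le_vpos _) _; apply: lD; split.
    by apply: Jpos; apply: JD; [exact: AJ | apply: JN; exact: AJ].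
  by rewrite vpos_ge0 vpos_le // vlerD2r ubx.
rewrite -(subrK a x); apply: JD; last exact: AJ.
by apply: (Jsolid _ l) => //; rewrite !ge0_vabs // (le_trans z0).
Qed.

End bands.

Lemma filter_ex2 (T : Type) (F : set_system T) {FF : ProperFilter F}
  (A B : set T) : F A -> F B -> exists2 t, A t & B t.
Proof. by move=> FA FB; have [t []] := filter_ex (filterI FA FB); exists t. Qed.

Section ultrafilter.
Context (R : realType) (X : banachLatticeType R) (T : Type) (F : set_system T).
Context {FU : UltraFilter F}.
Implicit Types (a b x y z u v s l : X) (e c : R).

(** Norm compactness of the order interval [0, s], as seen by F. *)
Definition interval_cvg s :=
  forall h : T -> X, (forall t, 0 <= h t <= s) -> cvg (h @ F).

Lemma interval_cvgS s u : s <= u -> interval_cvg u -> interval_cvg s.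
Proof. by move=> su us h hs; apply: us => t; have /andP[-> /le_trans->] := hs t. Qed.

(** h = h /\ s + (h - s)^+ has its summands in [0, s] and [0, u]. *)
Lemma interval_cvgD s u : 0 <= s -> 0 <= u ->
  interval_cvg s -> interval_cvg u -> interval_cvg (s + u).
Proof.
move=> s0 u0 cs cu h hsu.
have -> : h = (fun t => (h t `&` s)%O) \+ (fun t => h t - (h t `&` s)%O).
  by apply/funext => t /=; rewrite addrCA subrr addr0.
apply: is_cvgD.
  by apply: cs => t; have /andP[h0 _] := hsu t; rewrite lexI h0 s0 leIr.
apply: cu => t; have /andP[h0 hle] := hsu t.
by rewrite vsubrI vpos_ge0 vpos_le // vlerBlDr addrC.
Qed.

Lemma interval_cvgZ c s : 0 < c -> interval_cvg s -> interval_cvg (c *: s).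
Proof.
move=> c0 cs h hs; have c1 : 0 < c^-1 by rewrite invr_gt0.
have -> : h = (fun t => c *: (c^-1 *: h t)).
  by apply/funext => t; rewrite scalerKV // lt0r_neq0.
apply: is_cvgZl_tmp; apply: cs => t; have /andP[h0 hle] := hs t.
have c1' := ltW c1; rewrite vscaler_ge0 //= -[leRHS](scalerK (lt0r_neq0 c0)).
exact: vler_scale2l.
Qed.

(** h differs from the convergent h /\ u by (h - u)^+, of norm at most ||s - u||; so h is Cauchy
    along F. *)
Lemma interval_cvg_approx s :
  (forall e, 0 < e -> exists2 u, interval_cvg u & 0 <= u /\ `|u - s| <= e) ->
  interval_cvg s.
Proof.
move=> sP h hs; apply/cauchy_cvgP; apply: cauchy_exP => e e0.
have e20 : 0 < e / 2 by rewrite divr_gt0.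
have [u cu [u0 us]] := sP _ e20.
have /cvg_ex[l ul] : cvg ((fun t => (h t `&` u)%O) @ F).
  by apply: cu => t; rewrite lexI u0 leIr; have /andP[->] := hs t.
exists l; rewrite -ball_normE /=.
move/cvgrPdist_lt : ul => /(_ _ e20); apply: filterS => t /= lt.
rewrite -(subrKA (h t `&` u)%O) [e]splitr.
apply: le_lt_trans (ler_normD _ _) _; apply: ltr_leD => //.
rewrite distrC vsubrI; apply: le_trans us; rewrite [leRHS]distrC.
apply: lattice_norm_le; rewrite ge0_vabs ?vpos_ge0 //.
apply: le_trans (vpos_le_vabs _); apply: vpos_le; first exact: vpos_ge0.
by apply: le_trans (le_vpos _); rewrite vlerD2r; have /andP[] := hs t.
Qed.

(** On [0, a] a function is a scalar one times a, with coefficients in the compact [-1, 1]; a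
    cluster point of an ultrafilter is its limit. *)
Lemma interval_cvg_atom a : atom a -> interval_cvg a.
Proof.
move=> [a0 an0 aE] h ha.
have /choice[c cE] t : exists c, h t = c *: a.
  have : principal_ideal a (h t).
    move=> I [[_ _ _ Isolid] aI]; apply: (Isolid _ a); first exact: aI.
    by have /andP[h0 hle] := ha t; rewrite !ge0_vabs.
  by rewrite aE => -[c _ <-]; exists c.
have na : 0 < `|a| by rewrite normr_gt0.
have c1 t : -1 <= c t <= 1.
  have /andP[h0 hle] := ha t; rewrite -ler_norml -(ler_pM2r na) mul1r.
  by rewrite -normrZ -cE; exact: ge0_norm_le.
have [|l [_ cl]] := @segment_compact R (-1) 1 (c @ F) _.
  by apply: (@filterS _ F _ setT) filterT => t _; rewrite /= in_itv /= c1.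
have -> : h = (fun t => c t *: a) by apply/funext.
apply: is_cvgZr_tmp; apply/cvg_ex; exists l => A lA.
have [//|FnA] := in_ultra_setVsetC (c @^-1` A) FU.
by have [r [/= nAr /nAr]] := cl (~` A) A FnA lA.
Qed.


Lemma atomic_interval_cvg s : KB_space X -> atomic X -> 0 <= s -> interval_cvg s.
Proof.
move=> KB at_X s0; pose J := [set x | interval_cvg (vabs x)].
have : J s; last by rewrite /J /= ge0_vabs.
have : generated_band [set a : X | atom a] s by rewrite at_X.
apply; split; last first.
  by move=> a aa; rewrite /J /= ge0_vabs; [exact: interval_cvg_atom | case: aa].
have idJ : order_ideal J.
  split=> [|x y Jx Jy|c x Jx|x y Jy xy]; rewrite /J /=.
  - move=> h; rewrite vabs0 => h0; have -> : h = cst 0; last exact: is_cvg_cst.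
    by apply/funext => t; apply: le_anti; rewrite andbC; exact: h0.
  - apply: interval_cvgS (vabsD x y) _.
    by apply: interval_cvgD; rewrite ?vabs_ge0.
  (* [interval_cvgZ] asks for a positive factor, and c may be 0. *)
  - apply: (@interval_cvgS _ ((`|c| + 1) *: vabs x)).
      by rewrite vabs_scale vler_scale2r ?vabs_ge0 // lerDl.
    by apply: interval_cvgZ => //; rewrite ltr_wpDl.
  - exact: interval_cvgS xy Jy.
apply: closed_ideal_band => // x Jx; apply: interval_cvg_approx => e /Jx[y Jy yx].
exists (vabs y) => //; split; first exact: vabs_ge0.
by apply: le_trans yx; apply: lattice_norm_le; exact: vabs_dist_le.
Qed.

(* The truncations g /\ u converge along F to vectors Y u with Y u = Y w /\ u
   for u <= w; the limit of the net Y is the un-limit. *)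
Lemma nonneg_un_cvg (g : T -> X) : KB_space X -> atomic X ->
  (forall t, 0 <= g t) -> F [set t | `|g t| <= 1] ->
  exists y, forall u e, 0 <= u -> 0 < e ->
    F [set t | `|(vabs (g t - y) `&` u)%O| <= e].
Proof.
move=> KB at_X g0 g1.
have /choice[Y YP] u : exists y, 0 <= u -> forall e, 0 < e ->
    F [set t | `|(g t `&` u)%O - y| <= e].
  have [u0|] := pselect (0 <= u); last by exists 0.
  have /cvg_ex[y gy] : cvg ((fun t => (g t `&` u)%O) @ F).
    by apply: (atomic_interval_cvg KB at_X u0) => t; rewrite lexI g0 u0 leIr.
  exists y => _ e e0; have /cvgrPdist_le/(_ e e0) := gy.
  by apply: filterS => t /=; rewrite distrC.
have Y0 u : 0 <= u -> 0 <= Y u.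
  move=> u0; apply: ge0_norm_approx => e e0.
  by have /filter_ex[t] := YP u u0 e e0; exists (g t `&` u)%O; rewrite // lexI g0.
have Y1 u : 0 <= u -> `|Y u| <= 1.
  move=> u0; apply/ler_addgt0Pr => e e0.
  have [t gt1 gtY] := filter_ex2 g1 (YP u u0 e e0).
  rewrite -[Y u](subrKC (g t `&` u)%O).
  rewrite (le_trans (ler_normD _ _)) // lerD //; last by rewrite distrC.
  by apply: le_trans gt1; apply: ge0_norm_le; rewrite ?leIl // lexI g0.
have Ymeet u w : 0 <= u -> 0 <= w -> u <= w -> Y u = (Y w `&` u)%O.
  move=> u0 w0 uw; apply/eqP; rewrite -subr_eq0; apply/eqP.
  apply: norm_eps_eq0 => e e0; have e20 : 0 < e / 2 by rewrite divr_gt0.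
  have [t tu tw] := filter_ex2 (YP u u0 _ e20) (YP w w0 _ e20).
  rewrite -(subrKA (g t `&` u)%O) [e]splitr (le_trans (ler_normD _ _)) // lerD //.
    by rewrite distrC.
  have -> : (g t `&` u)%O = ((g t `&` w) `&` u)%O.
    by rewrite -meetA; congr (_ `&` _)%O; apply/esym/meet_idPr.
  exact: le_trans (norm_meet_le _ _ _) _.
have Yle u w : 0 <= u -> 0 <= w -> u <= w -> Y u <= Y w.
  by move=> u0 w0 uw; rewrite (Ymeet u w) // leIl.
have [|_ [u u0 <-]|_ [u u0 <-]|_ _ [u u0 <-] [w w0 <-]|l lD lim] :=
    @KB_directed R X KB [set Y u | u in [set u | 0 <= u]] 1.
- by exists (Y 0), 0; rewrite //= lexx.
- exact: Y0.
- exact: Y1.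
- have uw0 : 0 <= (u `|` w)%O by rewrite (le_trans u0) // leUl.
  exists (Y (u `|` w)%O); split; first by exists (u `|` w)%O.
    by rewrite Yle // leUl.
  by rewrite Yle // leUr.
have l0 : 0 <= l.
  by apply: (le_trans (Y0 0 (lexx 0))); apply: lD; exists 0; rewrite //= lexx.
have Yl u : 0 <= u -> Y u = (l `&` u)%O.
  move=> u0; apply/eqP; rewrite -subr_eq0; apply/eqP; apply: norm_eps_eq0 => e.
  move=> /lim[_ [w w0 <-] wP].
  have uw0 : 0 <= (u `|` w)%O by rewrite (le_trans u0) // leUl.
  rewrite (Ymeet u (u `|` w)%O) ?leUl // (le_trans (norm_meet_le _ _ _)) //.
  by apply: wP; [exists (u `|` w)%O | rewrite Yle // leUr].
(* Truncate at l + u: there the limit is l /\ (l + u) = l, and [vabs_meet_truncate] converts this to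
   the test against u. *)
exists l => u e u0 e0; have w0 : 0 <= l + u by exact: vaddr_ge0.
apply: filterS (YP _ w0 e e0) => t /=; rewrite Yl // [(l `&` _)%O]meet_l ?vler_wpDr //.
apply: le_trans; rewrite -[leRHS]norm_vabs; apply: ge0_norm_le.
  by rewrite lexI vabs_ge0.
exact: vabs_meet_truncate.
Qed.

End ultrafilter.

Lemma atomic_KB_un_compact (R : realType) (X : banachLatticeType R) :
  KB_space X -> atomic X -> un_compact (closed_unit_ball X).
Proof.
move=> KB at_X; rewrite /un_compact compact_ultra => F FU F1.
have pos1 x : `|x| <= 1 -> `|vpos x| <= 1.
  apply: le_trans; rewrite -[leRHS]norm_vabs.
  by apply: ge0_norm_le; [exact: vpos_ge0 | exact: vpos_le_vabs].
have [y1 y1P] : exists y1, forall u e, 0 <= u -> 0 < e ->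
    F [set x : X | `|(vabs (vpos x - y1) `&` u)%O| <= e].
  apply: nonneg_un_cvg => // [x|]; first exact: vpos_ge0.
  by apply: filterS F1 => x /=; exact: pos1.
have [y2 y2P] : exists y2, forall u e, 0 <= u -> 0 < e ->
    F [set x : X | `|(vabs (vpos (- x) - y2) `&` u)%O| <= e].
  apply: nonneg_un_cvg => // [x|]; first exact: vpos_ge0.
  by apply: filterS F1 => x /= x1; apply: pos1; rewrite normrN.
pose y := y1 - y2.
have yP u e : 0 <= u -> 0 < e -> F [set x : X | `|(vabs (x - y) `&` u)%O| < e].
  move=> u0 e0; have e40 : 0 < e / 4 by rewrite divr_gt0.
  apply: filterS (filterI (y1P u _ u0 e40) (y2P u _ u0 e40)) => x [/= le1 le2].
  have : `|(vabs (x - y) `&` u)%O| <= e / 4 + e / 4; last by lra.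
  apply: le_trans (lerD le1 le2); apply: le_trans (ler_normD _ _).
  apply: ge0_norm_le; first by rewrite lexI vabs_ge0.
  apply: le_trans (vmeetDl _ _ u0); rewrite ?vabs_ge0 //; apply: leI2 => //.
  have -> : x - y = (vpos x - y1) - (vpos (- x) - y2).
    by rewrite /y !opprB [y2 - vpos _]addrC addrACA vpos_subN [- y1 + y2]addrC.
  by rewrite (le_trans (vabsD _ _)) // vabsN.
exists y; split; last first.
  by move=> A [[e u] /= [e0 u0] sA]; apply: filterS sA _; exact: yP.
apply/ler_addgt0Pr => e e0.
(* The limit stays in the ball by testing against |y| itself: |y| <= |x| /\ |y| + |x - y| /\ |y|. *)
have [x x1 xy] := filter_ex2 F1 (yP (vabs y) e (vabs_ge0 y) e0).
rewrite -norm_vabs; apply: (@le_trans _ _ (`|vabs x| + `|(vabs (x - y) `&` vabs y)%O|)).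
  apply: le_trans (ler_normD _ _); apply: ge0_norm_le; first exact: vabs_ge0.
  apply: (@le_trans _ _ ((vabs x `&` vabs y)%O + (vabs (x - y) `&` vabs y)%O)).
    apply: le_trans (vmeetDl _ _ _); rewrite ?vabs_ge0 // lexI lexx andbT.
    by rewrite vdistC -{1}[y](subrK x) addrC vabsD.
  by rewrite vlerD2r leIl.
by rewrite norm_vabs lerD // ltW.
Qed.

Theorem theorem7p5 (R : realType) (X : banachLatticeType R) :
  [<-> un_compact (closed_unit_ball X);
       seq_un_compact (closed_unit_ball X);
       atomic X /\ KB_space X].
Proof.
tfae=> [co|co|[at_X KB]].
(* Compactness gives only cluster points; the KB property, itself a consequence, upgrades them to
   limits of subsequences. *)
- have H := un_compact_cluster co; have KB := un_cluster_KB H.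
  move=> x x1; have [l l1 xl] := H x x1.
  by have [k kincr kl] := un_cluster_subseq KB x1 xl; exists k; split=> //; exists l.
- have KB := un_cluster_KB (seq_un_compact_cluster co).
  by split=> //; exact: seq_un_compact_atomic.
exact: atomic_KB_un_compact.
Qed.
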